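(* Any subgroup $H$ of $PL_o(I)$ which admits a deep tower contains a subgroup isomorphic to $(\wr\mathbf{Z})^{\infty}$.
   Context: $PL_o(I)$ is the group of orientation-preserving piecewise-linear homeomorphisms of $I=[0,1]$ with finitely many breaks in slope, acting on the right. An orbital of $g$ is a connected component of the set of points moved by $g$. A signed orbital of $H$ is a pair $(A,g)$, $g\in H$, $A$ an orbital of $g$. A tower of $H$ is a set of signed orbitals of $H$ with pairwise distinct orbitals which are pairwise comparable under inclusion, ordered by inclusion of orbitals. A tower $T$ is deep if there is an order-preserving injection from the negative integers into $T$, i.e. $T$ contains signed orbitals $(A_{-1},g_{-1}),(A_{-2},g_{-2}),\ldots$ with $\cdots\subsetneq A_{-2}\subsetneq A_{-1}$. For permutation groups $(K,X)$, $(L,Y)$, the permutation wreath product $K\wr L$ is the subgroup of $\mathrm{Sym}(X\times Y)$ generated by the maps $(x,y)\mapsto(x\kappa,y)$, $(x,y')\mapsto(x,y')$ for $y'\neq y$ ($\kappa\in K$, $y\in Y$) and $(x,y)\mapsto(x,y\lambda)$ ($\lambda\in L$). Let $P_1=\mathbf{Z}$ acting on $\mathbf{Z}$ by translation and $P_{k+1}=\mathbf{Z}\wr P_k$ (permutation wreath product, $\mathbf{Z}$ acting on itself by translation), with $P_k$ embedded as the top group; $(\wr\mathbf{Z})^{\infty}=\ldots\wr(\mathbf{Z}\wr(\mathbf{Z}\wr\mathbf{Z}))$ is the ascending union of the $P_k$. *)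

(* Defs.v *)
From Stdlib Require Import Reals ZArith List.
Open Scope R_scope.

(* Elements of PL_o(I) are represented as maps R -> R which are the identity
   outside I = [0,1].  f is piecewise linear with finitely many breaks:
   there is a subdivision 0 = b 0 < b 1 < ... < b n = 1 such that f is affine
   with positive slope on each [b i, b (i+1)].  This makes f an orientation-
   preserving PL homeomorphism of [0,1]. *)
Definition PLo (f : R -> R) : Prop :=
  (forall x, (x < 0 \/ 1 < x) -> f x = x) /\
  f 0 = 0 /\ f 1 = 1 /\
  exists (n : nat) (b : nat -> R),
    b 0%nat = 0 /\ b n = 1 /\
    (forall i, (i < n)%nat -> b i < b (S i)) /\
    (forall i, (i < n)%nat -> exists a c, 0 < a /\
        forall x, b i <= x <= b (S i) -> f x = a * x + c).

(* Right action: the product "g then h" is the map x |-> h (g x). *)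
Definition subgroup_PLo (H : (R -> R) -> Prop) : Prop :=
  (forall h, H h -> PLo h) /\
  H (fun x => x) /\
  (forall g h, H g -> H h -> H (fun x => h (g x))) /\
  (forall g, H g -> exists g', H g' /\ (forall x, g' (g x) = x) /\ (forall x, g (g' x) = x)).

Definition moved (g : R -> R) (x : R) : Prop := 0 <= x <= 1 /\ g x <> x.

(* A is an orbital of g: the connected component (in the set of points
   moved by g) of some moved point x. *)
Definition orbital (g : R -> R) (A : R -> Prop) : Prop :=
  exists x, moved g x /\
    A = (fun y => forall z, Rmin x y <= z <= Rmax x y -> moved g z).

Definition incl (A B : R -> Prop) : Prop := forall x, A x -> B x.

Definition signed_orbital (H : (R -> R) -> Prop) (p : (R -> Prop) * (R -> R)) : Prop :=
  H (snd p) /\ orbital (snd p) (fst p).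

Definition tower (H : (R -> R) -> Prop) (T : (R -> Prop) * (R -> R) -> Prop) : Prop :=
  (forall p, T p -> signed_orbital H p) /\
  (forall p q, T p -> T q -> p <> q ->
     fst p <> fst q /\ (incl (fst p) (fst q) \/ incl (fst q) (fst p))).

(* Deep: an order-preserving injection from the negative integers into T.
   The negative integer -(n+1) is represented by n : nat, so n <= m
   corresponds to -(m+1) <= -(n+1). *)
Definition deep (T : (R -> Prop) * (R -> R) -> Prop) : Prop :=
  exists t : nat -> (R -> Prop) * (R -> R),
    (forall n, T (t n)) /\
    (forall n m, t n = t m -> n = m) /\
    (forall n m, (n <= m)%nat -> incl (fst (t m)) (fst (t n))).

Definition admits_deep_tower (H : (R -> R) -> Prop) : Prop :=
  exists T, tower H T /\ deep T.

(* P_k acts faithfully on Z^k (coordinates 0..k-1; coordinate 0 is the one of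
   P_1, and P_{k+1} = Z wr P_k adds the new coordinate k, on which the base
   group acts, the top group P_k acting on coordinates 0..k-1).  All P_k act
   compatibly on Z^N = nat -> Z (ignoring coordinates >= k), and
   (wr Z)^infinity is the subgroup of Sym(Z^N) generated by the generators
   wz_gen k y of the base groups: translate coordinate k by 1 on the
   points whose coordinates 0..k-1 equal those of y. *)
Definition seqZ := nat -> Z.

Definition agree (k : nat) (y s : seqZ) : bool :=
  forallb (fun i => Z.eqb (s i) (y i)) (List.seq 0 k).

Definition wz_shift (k : nat) (y : seqZ) (d : Z) (s : seqZ) : seqZ :=
  if agree k y s then (fun i => if Nat.eqb i k then (s i + d)%Z else s i) else s.

Inductive WZinf : (seqZ -> seqZ) -> Prop :=
| WZ_id : WZinf (fun s => s)
| WZ_gen : forall k y f, WZinf f -> WZinf (fun s => wz_shift k y 1%Z (f s))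
| WZ_geninv : forall k y f, WZinf f -> WZinf (fun s => wz_shift k y (-1)%Z (f s)).

Definition contains_WZinf (H : (R -> R) -> Prop) : Prop :=
  exists phi : (seqZ -> seqZ) -> (R -> R),
    (forall f, WZinf f -> H (phi f)) /\
    (forall f g, WZinf f -> WZinf g ->
        phi (fun s => g (f s)) = (fun x => phi g (phi f x))) /\
    (forall f g, WZinf f -> WZinf g -> phi f = phi g -> f = g).

(* Main.v *)
(* Call a pair of overlapping, non-nested orbitals of elements of L a chain of L. It suffices to
   find h_0, h_1, ... in H such that h_(k+1) is trivial near every fixed point of h_k. After
   replacing each h_k by a suitable power e_k, the support of e_(k+1) is disjoint from all its
   translates by nonzero powers of e_k, so an n-tuple of exponents addresses a translate of the support of e_n, and the
   e_k generate a copy of the iterated wreath product by acting on addresses.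

   The h_k are chosen inductively, keeping that the elements trivial near Fix(h_k) form a group
   with a chain or a deep tower.
   - Without chains, orbitals are nested or disjoint and two of them never share exactly one end,
     since otherwise a commutator would create a chain. For a deep tower (A_n, g_n) and f = g_0,
     the elements [F, F^(g_n^k)], with F a large power of f and k large, are trivial near Fix(f)
     and agree with g_n^k on A_n.
   - For a chain (f, g), let L be the group of elements trivial near every common fixed point of
     f and g. If L has no chain, then [f, g] is in L and has an orbital J containing an end of the
     chain, and the images of J under powers of f or of g form a deep tower of L.
     If L has a chain (x, y), some element of H has no fixed point on the supports of x and y:
     conjugate f and g so that the ends of their orbitals leave these supports, and multiply
     large powers of the conjugates. *)

Require Import Defs.
From Stdlib Require Import Reals ZArith List.
From Stdlib Require Import Lra Lia Classical ClassicalEpsilon FunctionalExtensionality PropExtensionality.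
Open Scope R_scope.

(** * Increasing homeomorphisms of the line, their orbitals and their powers *)

Lemma choose {A B : Type} (P : A -> B -> Prop) :
  (forall a, exists b, P a b) -> exists f : A -> B, forall a, P a (f a).
Proof.
  intros H; exists (fun a => proj1_sig (constructive_indefinite_description _ (H a))).
  intros a; apply proj2_sig.
Qed.

(** Choosing preimages makes inversion a total operation on functions; it is the two-sided inverse
    as soon as [homeo h] holds. *)
Definition inv (h : R -> R) : R -> R :=
  fun y => epsilon (inhabits 0) (fun x => h x = y).

Definition homeo (h : R -> R) : Prop :=
  (forall x y, x < y -> h x < h y) /\ (forall y, exists x, h x = y).

Fixpoint pw (h : R -> R) (n : nat) (x : R) : R :=
  match n with O => x | S m => h (pw h m x) end.

Definition cj (w k : R -> R) : R -> R := fun x => k (w (inv k x)).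

(** In the right action this is the commutator [f^-1 g^-1 f g], just as [cj w k] is [k^-1 w k]. *)
Definition comm (f g : R -> R) : R -> R := fun x => g (f (inv g (inv f x))).

(** An orbital is recorded by its two ends, so that comparing orbitals becomes comparing reals. *)
Definition Orb (h : R -> R) (p q : R) : Prop :=
  p < q /\ h p = p /\ h q = q /\ forall z, p < z < q -> h z <> z.

Definition near_id (u : R -> R) (z : R) : Prop :=
  exists e, 0 < e /\ forall y, z - e < y < z + e -> u y = y.

Lemma homeo_lt h x y : homeo h -> h x < h y <-> x < y.
Proof.
  intros [Hi _]; split; auto.
  intros Hxy; destruct (Rtotal_order x y) as [?|[->|Hl]]; auto; try lra.
  apply Hi in Hl; lra.
Qed.

Lemma homeo_le h x y : homeo h -> h x <= h y <-> x <= y.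
Proof.
  intros Hh; pose proof (homeo_lt h y x Hh); split; intros Hxy;
    apply Rnot_lt_le; intros Hlt; apply H in Hlt; lra.
Qed.

Lemma homeo_inj h x y : homeo h -> h x = h y -> x = y.
Proof.
  intros Hh Hxy; apply Rle_antisym; apply (homeo_le h); auto; lra.
Qed.

Lemma homeo_Kinv h y : homeo h -> h (inv h y) = y.
Proof. intros [_ Hs]; apply (epsilon_spec (inhabits 0) (fun x => h x = y)); auto. Qed.

Lemma homeo_invK h x : homeo h -> inv h (h x) = x.
Proof. intros Hh; apply (homeo_inj h); auto; apply homeo_Kinv; auto. Qed.

Lemma inv_unique h g : homeo h -> (forall x, h (g x) = x) -> inv h = g.
Proof.
  intros Hh Hg; apply functional_extensionality; intros x.
  apply (homeo_inj h); auto; rewrite Hg; apply homeo_Kinv; auto.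
Qed.

Lemma homeo_inv h : homeo h -> homeo (inv h).
Proof.
  intros Hh; split.
  - intros x y Hxy; apply (homeo_lt h); auto; rewrite !homeo_Kinv; auto.
  - intros y; exists (h y); apply homeo_invK; auto.
Qed.

Lemma homeo_comp g h : homeo g -> homeo h -> homeo (fun x => h (g x)).
Proof.
  intros [Hg Sg] [Hh Sh]; split; auto.
  intros y; destruct (Sh y) as [z <-]; destruct (Sg z) as [x <-]; eauto.
Qed.

Lemma homeo_pw h n : homeo h -> homeo (pw h n).
Proof.
  intros Hh; induction n.
  - split; simpl; eauto.
  - exact (homeo_comp (pw h n) h IHn Hh).
Qed.

Lemma homeo_cj w k : homeo w -> homeo k -> homeo (cj w k).
Proof.
  intros Hw Hk; unfold cj.
  apply (homeo_comp (inv k) (fun x => k (w x))); [apply homeo_inv|apply homeo_comp]; auto.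
Qed.

Lemma inv_fix h x : homeo h -> inv h x = x <-> h x = x.
Proof.
  intros Hh; split; intros H.
  - rewrite <- H at 1; apply homeo_Kinv; auto.
  - rewrite <- H at 1; apply homeo_invK; auto.
Qed.

Lemma inv_cj w k x : homeo w -> homeo k -> inv (cj w k) x = cj (inv w) k x.
Proof.
  intros Hw Hk; rewrite (inv_unique (cj w k) (cj (inv w) k)); auto.
  - apply homeo_cj; auto.
  - intros y; unfold cj; rewrite homeo_invK, !homeo_Kinv; auto.
Qed.

Lemma cj_fix w k z : homeo k -> cj w k (k z) = k z <-> w z = z.
Proof.
  intros Hk; unfold cj; rewrite homeo_invK by auto; split; intros H.
  - apply (homeo_inj k); auto.
  - rewrite H; auto.
Qed.

Lemma pw_add h n m x : pw h (n + m) x = pw h n (pw h m x).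
Proof. induction n; simpl; congruence. Qed.

Lemma pw_fix h n x : h x = x -> pw h n x = x.
Proof. intros H; induction n; simpl; congruence. Qed.

Lemma pw_gt h n x : homeo h -> x < h x -> (1 <= n)%nat -> x < pw h n x.
Proof.
  intros Hh Hx Hn; induction n as [|[|n] IH]; [lia|simpl; auto|].
  apply Rlt_trans with (h x); auto.
  change (h x < h (pw h (S n) x)); apply homeo_lt; auto; apply IH; lia.
Qed.

Lemma pw_lt h n x : homeo h -> h x < x -> (1 <= n)%nat -> pw h n x < x.
Proof.
  intros Hh Hx Hn; induction n as [|[|n] IH]; [lia|simpl; auto|].
  apply Rlt_trans with (h x); auto.
  change (h (pw h (S n) x) < h x); apply homeo_lt; auto; apply IH; lia.
Qed.

Lemma pw_fix_iff h n x : homeo h -> (1 <= n)%nat -> pw h n x = x <-> h x = x.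
Proof.
  intros Hh Hn; split; [intros H|apply pw_fix].
  destruct (Rtotal_order (h x) x) as [Hl|[?|Hg]]; auto.
  - pose proof (pw_lt h n x Hh Hl Hn); lra.
  - pose proof (pw_gt h n x Hh Hg Hn); lra.
Qed.

Lemma Orb_inv h p q : homeo h -> Orb h p q -> Orb (inv h) p q.
Proof.
  intros Hh (H1 & H2 & H3 & H4); repeat split; auto; try (apply inv_fix; auto).
  intros z Hz; rewrite inv_fix; auto.
Qed.

Lemma Orb_cj w k p q : homeo k -> Orb w p q -> Orb (cj w k) (k p) (k q).
Proof.
  intros Hk (H1 & H2 & H3 & H4); repeat split.
  - apply homeo_lt; auto.
  - apply cj_fix; auto.
  - apply cj_fix; auto.
  - intros z Hz; rewrite <- (homeo_Kinv k z) by auto; rewrite cj_fix by auto.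
    apply H4; rewrite <- (homeo_Kinv k z) in Hz by auto.
    rewrite !homeo_lt in Hz; auto.
Qed.

Lemma homeo_stable k p q x : homeo k -> k p = p -> k q = q ->
  p < x < q -> p < k x < q.
Proof.
  intros Hk Hp Hq [H1 H2].
  apply (homeo_lt k) in H1; apply (homeo_lt k) in H2; auto; lra.
Qed.

Lemma Orb_unique h p q q' : Orb h p q -> Orb h p q' -> q = q'.
Proof.
  intros (H1 & _ & H3 & H4) (H1' & _ & H3' & H4').
  destruct (Rtotal_order q q') as [?|[?|?]]; auto; exfalso.
  - apply (H4' q); auto.
  - apply (H4 q'); auto.
Qed.

Lemma Orb_fix_le h p q u z : Orb h p q -> p < z < q -> h u = u -> u <= z -> u <= p.
Proof.
  intros (_ & _ & _ & H4) Hz Hu Huz; apply Rnot_lt_le; intros Hlt.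
  apply (H4 u); auto; lra.
Qed.

Lemma Orb_fix_ge h p q u z : Orb h p q -> p < z < q -> h u = u -> z <= u -> q <= u.
Proof.
  intros (_ & _ & _ & H4) Hz Hu Huz; apply Rnot_lt_le; intros Hlt.
  apply (H4 u); auto; lra.
Qed.

(** [h] maps [E] onto itself and preserves the order, hence it preserves the supremum. *)
Lemma lub_fixed h (E : R -> Prop) s : homeo h ->
  (forall x, E x -> E (h x)) -> (forall x, E x -> E (inv h x)) -> is_lub E s -> h s = s.
Proof.
  intros Hh H1 H2 [Hub Hl]; apply Rle_antisym.
  - rewrite <- (homeo_Kinv h s) at 2 by auto; apply homeo_le; auto.
    apply Hl; intros x Hx; apply (homeo_le h); auto.
    rewrite homeo_Kinv; auto.
  - apply Hl; intros x Hx; rewrite <- (homeo_Kinv h x) by auto; apply homeo_le; auto.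
Qed.

(** The conjugate by the reflection of the line; it transfers statements to their mirror images. *)
Definition refl (h : R -> R) : R -> R := fun x => - h (- x).

Lemma homeo_refl h : homeo h -> homeo (refl h).
Proof.
  intros Hh; unfold refl; split.
  - intros x y Hxy; apply Ropp_lt_contravar; apply homeo_lt; auto; lra.
  - intros y; exists (- inv h (- y)); rewrite Ropp_involutive, homeo_Kinv by auto; lra.
Qed.

Lemma pw_refl h n x : pw (refl h) n x = - pw h n (- x).
Proof.
  induction n; simpl; [lra|].
  rewrite IHn; unfold refl; rewrite Ropp_involutive; auto.
Qed.

(** If the forward orbit never passes [y], the supremum of the full orbit is a fixed point. *)
Lemma escape_or_fix h x y : homeo h -> x < h x -> 
  (exists n, y < pw h n x) \/ (exists s, h s = s /\ x < s <= y).
Proof.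
  intros Hh Hx; destruct (classic (exists n, y < pw h n x)) as [?|Hn]; auto; right.
  assert (Hle : forall n, pw h n x <= y)
    by (intros n; apply Rnot_lt_le; intros Hlt; apply Hn; eauto).
  (* Backward iterates are included to make [E] invariant under [inv h] as well. *)
  set (E t := exists n, pw h n x = t \/ pw (inv h) n x = t).
  assert (Hinv : forall n, pw (inv h) n x <= x).
  { intros [|n]; [simpl; lra|].
    apply Rlt_le, pw_lt; try lia; [apply homeo_inv; auto|].
    apply (homeo_lt h); auto; rewrite homeo_Kinv; auto. }
  destruct (completeness E) as [s Hs].
  - exists y; intros t [n [<-|<-]]; auto.
    apply Rle_trans with x; auto; apply (Hle 0%nat).
  - exists x, 0%nat; auto.
  - exists s; repeat split.
    + apply (lub_fixed h E); auto.
      * intros t [n [<-|<-]].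
        -- exists (S n); auto.
        -- destruct n; [exists 1%nat; auto|exists n; right].
           simpl; rewrite homeo_Kinv; auto.
      * intros t [n [<-|<-]].
        -- destruct n; [exists 1%nat; auto|exists n; left].
           simpl; rewrite homeo_invK; auto.
        -- exists (S n); auto.
    + apply Rlt_le_trans with (h x); auto; apply Hs; exists 1%nat; auto.
    + apply Hs; intros t [n [<-|<-]]; auto.
      apply Rle_trans with x; auto; apply (Hle 0%nat).
Qed.

Lemma Orb_sign h a b : homeo h -> Orb h a b ->
  (forall x, a < x < b -> x < h x) \/ (forall x, a < x < b -> h x < x).
Proof.
  intros Hh Ho; pose proof Ho as (Hab & Ha & Hb & Hm).
  (* opposite signs at two points trap an orbit, whose supremum is fixed *)
  assert (K : forall k x y, homeo k -> Orb k a b -> a < x < b -> a < y < b -> x < y ->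
            x < k x -> k y < y -> False).
  { intros k x y Hk (_ & _ & _ & Hmk) Hx Hy Hxy Hkx Hky.
    destruct (escape_or_fix k x y Hk Hkx) as [[n Hn]|[s [Hs Hsx]]].
    - pose proof (proj2 (homeo_lt _ x y (homeo_pw k n Hk)) Hxy).
      destruct n; [simpl in *; lra|].
      assert (pw k (S n) y < y) by (apply pw_lt; auto; lia); lra.
    - apply (Hmk s); auto; lra. }
  destruct (classic (forall x, a < x < b -> x < h x)) as [?|Hr]; auto; right.
  apply not_all_ex_not in Hr; destruct Hr as [y Hy].
  apply imply_to_and in Hy; destruct Hy as [Hy Hy'].
  assert (h y < y) by (specialize (Hm y Hy); lra).
  intros x Hx; apply Rnot_le_lt; intros Hle.
  assert (Hx' : x < h x) by (specialize (Hm x Hx); lra).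
  destruct (Rtotal_order x y) as [Hl|[->|Hl]]; [eauto|lra|].
  apply (K (inv h) y x); auto.
  - apply homeo_inv; auto.
  - apply Orb_inv; auto.
  - apply (homeo_lt h); auto; rewrite homeo_Kinv; auto.
  - apply (homeo_lt h); auto; rewrite homeo_Kinv; auto.
Qed.

Lemma pw_mono_right h n m x : homeo h -> x < h x -> (n <= m)%nat -> pw h n x <= pw h m x.
Proof.
  intros Hh Hx Hnm; replace m with (n + (m - n))%nat by lia; rewrite pw_add.
  apply homeo_le; [apply homeo_pw; auto|].
  destruct (m - n)%nat; [simpl; lra|]; apply Rlt_le, pw_gt; auto; lia.
Qed.

Lemma escape_right h a b x y : homeo h -> Orb h a b -> a < x < b -> x < h x -> y < b ->
  exists N, forall n, (N <= n)%nat -> y < pw h n x.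
Proof.
  intros Hh (_ & _ & _ & Hm) Hx Hhx Hy.
  destruct (escape_or_fix h x y Hh Hhx) as [[N HN]|[s [Hs Hsx]]].
  - exists N; intros n Hn; pose proof (pw_mono_right h N n x Hh Hhx Hn); lra.
  - exfalso; apply (Hm s); auto; lra.
Qed.

Lemma Orb_refl h a b : Orb h a b -> Orb (refl h) (- b) (- a).
Proof.
  intros (H1 & H2 & H3 & H4); unfold refl; repeat split.
  - lra.
  - rewrite Ropp_involutive; lra.
  - rewrite Ropp_involutive; lra.
  - intros z Hz E; apply (H4 (- z)); lra.
Qed.

Lemma escape_left h a b x y : homeo h -> Orb h a b -> a < x < b -> h x < x -> a < y ->
  exists N, forall n, (N <= n)%nat -> pw h n x < y.
Proof.
  intros Hh Ho Hx Hhx Hy.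
  destruct (escape_right (refl h) (- b) (- a) (- x) (- y)) as [N HN];
    auto using homeo_refl, Orb_refl; try lra.
  - unfold refl; rewrite Ropp_involutive; lra.
  - exists N; intros n Hn; specialize (HN n Hn).
    rewrite pw_refl, Ropp_involutive in HN; lra.
Qed.

(** All points of an orbital move in one direction, so high powers carry the whole of [[p, q]]
    beyond [q'] or below [p']. *)
Lemma displace h a b p q p' q' : homeo h -> Orb h a b ->
  a < p -> p <= q -> q < b -> a < p' -> p' <= q' -> q' < b ->
  exists N, forall n, (N <= n)%nat -> forall x, p <= x <= q -> ~ p' <= pw h n x <= q'.
Proof.
  intros Hh Ho H1 H2 H3 H4 H5 H6.
  destruct (Orb_sign h a b Hh Ho) as [Hs|Hs].
  - destruct (escape_right h a b p q' Hh Ho) as [N HN]; try lra; [apply Hs; lra|].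
    exists N; intros n Hn x Hx Hc; specialize (HN n Hn).
    pose proof (proj2 (homeo_le _ p x (homeo_pw h n Hh)) (proj1 Hx)); lra.
  - destruct (escape_left h a b q p' Hh Ho) as [N HN]; try lra; [apply Hs; lra|].
    exists N; intros n Hn x Hx Hc; specialize (HN n Hn).
    pose proof (proj2 (homeo_le _ x q (homeo_pw h n Hh)) (proj2 Hx)); lra.
Qed.

Lemma list_uniform {A : Type} (l : list A) (P : A -> nat -> Prop) :
  (forall a, In a l -> exists N, forall n, (N <= n)%nat -> P a n) ->
  exists N, forall n, (N <= n)%nat -> forall a, In a l -> P a n.
Proof.
  induction l as [|a l IH]; intros H.
  - exists 0%nat; intros n _ a [].
  - destruct (H a) as [N1 H1]; [left; auto|].
    destruct IH as [N2 H2]; [intros; apply H; right; auto|].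
    exists (max N1 N2); intros n Hn b [<-|Hb]; [apply H1|apply H2]; auto; lia.
Qed.

(** * The piecewise linear structure *)

Lemma PLo_incr f : PLo f -> forall x y, x < y -> f x < f y.
Proof.
  intros (Hout & H0 & H1 & n & b & Hb0 & Hbn & Hb & Hp).
  assert (K : forall m, (m <= n)%nat -> forall x y, 0 <= x -> x < y -> y <= b m -> f x < f y).
  { induction m as [|m IH]; intros Hm x y Hx Hxy Hy; [lra|].
    destruct (Hp m) as (a & c & Ha & Hf); [lia|].
    assert (P : forall u v, b m <= u -> u < v -> v <= b (S m) -> f u < f v).
    { intros u v Hu Huv Hv; rewrite !Hf by lra.
      pose proof (Rmult_lt_compat_l a u v Ha Huv); lra. }
    assert (Hbm : b m < b (S m)) by (apply Hb; lia).
    destruct (Rle_lt_dec y (b m)) as [?|Hym]; [apply IH; auto; lia|].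
    destruct (Rle_lt_dec (b m) x) as [?|Hxm]; [apply P; auto|].
    apply Rlt_trans with (f (b m)); [apply IH; auto; [lia|lra]|apply P; lra]. }
  specialize (K n (le_n n)); rewrite Hbn in K.
  assert (B : forall x, 0 <= x <= 1 -> 0 <= f x <= 1).
  { intros x [[Hx| <-] [Hx'| ->]]; try lra.
    - pose proof (K 0 x); pose proof (K x 1); lra. }
  intros x y Hxy.
  destruct (Rlt_le_dec x 0), (Rlt_le_dec y 0), (Rlt_le_dec 1 x), (Rlt_le_dec 1 y); try lra;
    try pose proof (B x); try pose proof (B y);
    try rewrite (Hout x) by lra; try rewrite (Hout y) by lra; try lra.
  apply K; lra.
Qed.

Lemma PLo_germ_right f z : PLo f ->
  exists e a, 0 < e /\ forall s, 0 <= s <= e -> f (z + s) = f z + a * s.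
Proof.
  intros (Hout & H0 & H1 & n & b & Hb0 & Hbn & Hb & Hp).
  destruct (Rlt_le_dec z 0) as [Hz|Hz]; [|destruct (Rle_lt_dec 1 z) as [Hz1|Hz1]].
  - exists (- z / 2), 1; split; [lra|]; intros s Hs; rewrite !Hout; lra.
  - exists 1, 1; split; [lra|]; intros s Hs.
    assert (Hid : forall t, 1 <= t -> f t = t) by (intros t [?| <-]; auto).
    rewrite !Hid; lra.
  - assert (K : forall m, (m <= n)%nat -> z < b m ->
              exists i, (i < m)%nat /\ b i <= z < b (S i)).
    { induction m as [|m IH]; intros Hm Hzm; [lra|].
      destruct (Rlt_le_dec z (b m)) as [Hl|Hl].
      - destruct IH as [i [Hi Hi']]; auto; [lia|exists i; split; auto].
      - exists m; auto. }
    destruct (K n) as [i [Hi Hi']]; auto; [lra|].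
    destruct (Hp i Hi) as (a & c & Ha & Hf).
    exists (b (S i) - z), a; split; [lra|]; intros s Hs; rewrite !Hf by lra; ring.
Qed.

Lemma PLo_germ_left f z : PLo f ->
  exists e a, 0 < e /\ forall s, 0 <= s <= e -> f (z - s) = f z - a * s.
Proof.
  intros (Hout & H0 & H1 & n & b & Hb0 & Hbn & Hb & Hp).
  destruct (Rle_lt_dec z 0) as [Hz|Hz]; [|destruct (Rlt_le_dec 1 z) as [Hz1|Hz1]].
  - exists 1, 1; split; [lra|]; intros s Hs.
    assert (Hid : forall t, t <= 0 -> f t = t) by (intros t [?| ->]; auto).
    rewrite !Hid; lra.
  - exists ((z - 1) / 2), 1; split; [lra|]; intros s Hs; rewrite !Hout; lra.
  - assert (K : forall m, (m <= n)%nat -> z <= b m ->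
              exists i, (i < m)%nat /\ b i < z <= b (S i)).
    { induction m as [|m IH]; intros Hm Hzm; [lra|].
      destruct (Rle_lt_dec z (b m)) as [Hl|Hl].
      - destruct IH as [i [Hi Hi']]; auto; [lia|exists i; split; auto].
      - exists m; auto. }
    destruct (K n) as [i [Hi Hi']]; auto; [lra|].
    destruct (Hp i Hi) as (a & c & Ha & Hf).
    exists (z - b i), a; split; [lra|]; intros s Hs; rewrite !Hf by lra; ring.
Qed.

Lemma PLo_moved_bounds f z : PLo f -> f z <> z -> 0 < z < 1.
Proof.
  intros (Hout & H0 & H1 & _) Hz; split; apply Rnot_le_lt.
  - intros [?| ->]; auto.
  - intros [?| <-]; auto.
Qed.

Lemma closest_fixed_below (F : R -> Prop) u z : F u -> u <= z ->
  exists s, is_lub (fun t => F t /\ t <= z) s /\ u <= s <= z.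
Proof.
  intros Hu Huz; destruct (completeness (fun t => F t /\ t <= z)) as [s [Hs Hs']].
  - exists z; intros t [_ Ht]; auto.
  - exists u; auto.
  - exists s; repeat split; auto.
    apply Hs'; intros t [_ Ht]; auto.
Qed.

Lemma fixed_lub h (F : R -> Prop) s : homeo h -> (forall t, F t -> h t = t) ->
  is_lub F s -> h s = s.
Proof.
  intros Hh HF Hs; apply (lub_fixed h F); auto.
  - intros x Hx; rewrite HF; auto.
  - intros x Hx; rewrite (proj2 (inv_fix h x Hh)); auto.
Qed.

(** The ends are the nearest fixed points on either side, which exist by completeness; the upper one
    is the lower one of the reflected map. *)
Lemma Orb_exists f z : PLo f -> homeo f -> f z <> z -> exists p q, Orb f p q /\ p < z < q.
Proof.
  intros Hf Hh Hz; pose proof (PLo_moved_bounds f z Hf Hz) as Hz01.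
  pose proof Hf as (_ & H0 & H1 & _).
  destruct (closest_fixed_below (fun t => f t = t) 0 z) as [p [Hp Hp']]; auto; try lra.
  destruct (closest_fixed_below (fun t => refl f t = t) (- 1) (- z)) as [q [Hq Hq']]; try lra.
  { unfold refl; replace (- (- 1)) with 1 by ring; lra. }
  assert (Fp : f p = p) by (apply (fixed_lub f _ p Hh) in Hp; auto; intros t [? _]; auto).
  assert (Fq : refl f q = q).
  { apply (fixed_lub _ _ q (homeo_refl f Hh)) in Hq; auto; intros t [? _]; auto. }
  assert (p <> z) by (intros ->; auto).
  assert (Fq' : f (- q) = - q) by (unfold refl in Fq; lra).
  assert (- q <> z) by (intros E; rewrite E in Fq'; auto).
  exists p, (- q); repeat split; auto; try lra.
  intros t Ht Et; destruct (Rle_lt_dec t z).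
  - assert (t <= p) by (apply Hp; auto); lra.
  - assert (- t <= q); [|lra].
    apply Hq; unfold refl; rewrite Ropp_involutive; lra.
Qed.

(** With slope 1 to the right of [p] the map is trivial there; otherwise [p] is an isolated fixed
    point on that side, and the orbital just after it starts at [p]. *)
Lemma germ_right_cases g p : PLo g -> homeo g -> g p = p ->
  (exists e, 0 < e /\ forall x, p <= x <= p + e -> g x = x) \/ exists q, Orb g p q.
Proof.
  intros Hg Hh Hp; destruct (PLo_germ_right g p Hg) as (e & a & He & Hs).
  destruct (Req_dec a 1) as [->|Ha].
  - left; exists e; split; auto; intros x Hx.
    replace x with (p + (x - p)) by ring; rewrite Hs by lra; lra.
  - right.
    assert (Hm : forall x, p < x <= p + e -> g x <> x).
    { intros x Hx E; assert (Hx' := Hs (x - p)).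
      replace (p + (x - p)) with x in Hx' by ring.
      rewrite E, Hp in Hx' by lra.
      assert ((a - 1) * (x - p) = 0) by (specialize (Hx' ltac:(lra)); lra).
      apply Rmult_integral in H; lra. }
    destruct (Orb_exists g (p + e)) as (u & v & Ho & Huv); auto; [apply Hm; lra|].
    exists v; replace p with u; auto.
    pose proof (Orb_fix_le g u v p (p + e) Ho Huv Hp).
    destruct (Rle_lt_dec u p); [lra|].
    exfalso; apply (Hm u); [lra|apply Ho].
Qed.

Lemma germ_left_cases g p : PLo g -> homeo g -> g p = p ->
  (exists e, 0 < e /\ forall x, p - e <= x <= p -> g x = x) \/ exists q, Orb g q p.
Proof.
  intros Hg Hh Hp; destruct (PLo_germ_left g p Hg) as (e & a & He & Hs).
  destruct (Req_dec a 1) as [->|Ha].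
  - left; exists e; split; auto; intros x Hx.
    replace x with (p - (p - x)) by ring; rewrite Hs by lra; lra.
  - right.
    assert (Hm : forall x, p - e <= x < p -> g x <> x).
    { intros x Hx E; assert (Hx' := Hs (p - x)).
      replace (p - (p - x)) with x in Hx' by ring.
      rewrite E, Hp in Hx' by lra.
      assert ((a - 1) * (p - x) = 0) by (specialize (Hx' ltac:(lra)); lra).
      apply Rmult_integral in H; lra. }
    destruct (Orb_exists g (p - e)) as (u & v & Ho & Huv); auto; [apply Hm; lra|].
    exists u; replace p with v; auto.
    pose proof (Orb_fix_ge g u v p (p - e) Ho Huv Hp).
    destruct (Rle_lt_dec p v); [lra|].
    exfalso; apply (Hm v); [lra|apply Ho].
Qed.

(* The left end of an orbital is the unique fixed point of the affine piece to its right. *)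
Lemma PLo_orbitals_finite f : PLo f -> homeo f -> exists l : list (R * R),
  (forall p q, In (p, q) l -> Orb f p q) /\
  (forall z, f z <> z -> exists p q, In (p, q) l /\ p < z < q).
Proof.
  intros Hf Hh.
  assert (HE : exists E : list R, forall p q, Orb f p q -> In p E).
  { pose proof Hf as (Hout & H0 & H1 & n & b & Hb0 & Hbn & Hb & Hp).
    assert (K : forall m, (m <= n)%nat -> exists E : list R,
              forall p q, 0 <= p -> Orb f p q -> p < b m -> In p E).
    { induction m as [|m IH]; intros Hm; [exists nil; intros; lra|].
      destruct IH as [E HE]; [lia|].
      destruct (Hp m) as (a & c & Ha & Hpc); [lia|].
      exists (c / (1 - a) :: E); intros p q Hp0 Ho Hpm.
      destruct (Rlt_le_dec p (b m)) as [?|Hmp]; [right; eauto|left].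
      destruct Ho as (Hpq & Fp & _ & Hmv).
      (* [t] lies in the orbital and in the affine piece; since [f] moves it, the piece cannot be
         the identity, so its slope is not 1. *)
      set (t := (p + Rmin q (b (S m))) / 2).
      assert (Ht : p < t < q /\ t <= b (S m))
        by (unfold t, Rmin; destruct (Rle_dec q (b (S m))); lra).
      assert (Mt : f t <> t) by (apply Hmv; lra).
      rewrite Hpc in Fp, Mt by lra.
      assert (a <> 1) by (intros ->; apply Mt; lra).
      apply Rmult_eq_reg_r with (1 - a); [field_simplify|]; lra. }
    destruct (K n) as [E HE]; auto; exists E; intros p q Ho; apply (HE p q); auto.
    - apply Rnot_lt_le; intros Hl; pose proof Ho as (Hpq & _ & _ & Hmv).
      apply (Hmv ((p + Rmin q 0) / 2)); [|apply Hout; left];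
        unfold Rmin; destruct (Rle_dec q 0); lra.
    - rewrite Hbn; apply Rnot_le_lt; intros Hl; pose proof Ho as (Hpq & _ & _ & Hmv).
      apply (Hmv ((p + q) / 2)); [|apply Hout; right]; lra. }
  destruct HE as [E HE].
  assert (K : exists l : list (R * R), (forall p q, In (p, q) l -> Orb f p q) /\
            forall p q, In p E -> Orb f p q -> In (p, q) l).
  { clear HE; induction E as [|e E (l & Hl & Hl')].
    - exists nil; split; [intros p q []|intros p q []].
    - destruct (classic (exists q, Orb f e q)) as [[q Hq]|Hn].
      + exists ((e, q) :: l); split.
        * intros p q' [H|H]; [inversion H; subst; auto|auto].
        * intros p q' [<-|H] Ho; [left; rewrite (Orb_unique f e q q'); auto|right; auto].
      + exists l; split; auto; intros p q [<-|H] Ho; [exfalso; eauto|auto]. }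
  destruct K as (l & Hl & Hl'); exists l; split; auto.
  intros z Hz; destruct (Orb_exists f z Hf Hh Hz) as (p & q & Ho & Hpq); eauto 6.
Qed.

(** * Triviality near a point, and commutators at common fixed points *)

Lemma near_id_right u z : near_id u z -> exists e, 0 < e /\ forall y, z <= y <= z + e -> u y = y.
Proof. intros (e & He & H); exists (e / 2); split; [lra|]; intros; apply H; lra. Qed.

Lemma near_id_left u z : near_id u z -> exists e, 0 < e /\ forall y, z - e <= y <= z -> u y = y.
Proof. intros (e & He & H); exists (e / 2); split; [lra|]; intros; apply H; lra. Qed.

Lemma near_id_open u c d z : c < z < d -> (forall y, c < y < d -> u y = y) -> near_id u z.
Proof.
  intros Hz H; exists (Rmin (z - c) (d - z)); split.
  - apply Rmin_glb_lt; lra.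
  - intros y Hy; apply H; pose proof (Rmin_l (z - c) (d - z)).
    pose proof (Rmin_r (z - c) (d - z)); lra.
Qed.

Lemma near_id_Orb_left u p q : near_id u p -> ~ Orb u p q.
Proof.
  intros H (Hpq & _ & _ & Hm); destruct (near_id_right u p H) as (e & He & Hid).
  pose proof (Rmin_l (p + e) ((p + q) / 2)); pose proof (Rmin_r (p + e) ((p + q) / 2)).
  assert (p < Rmin (p + e) ((p + q) / 2)) by (apply Rmin_glb_lt; lra).
  apply (Hm (Rmin (p + e) ((p + q) / 2))); [lra|apply Hid; lra].
Qed.

Lemma near_id_Orb_right u p q : near_id u q -> ~ Orb u p q.
Proof.
  intros H (Hpq & _ & _ & Hm); destruct (near_id_left u q H) as (e & He & Hid).
  pose proof (Rmax_l (q - e) ((p + q) / 2)); pose proof (Rmax_r (q - e) ((p + q) / 2)).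
  assert (Rmax (q - e) ((p + q) / 2) < q) by (apply Rmax_lub_lt; lra).
  apply (Hm (Rmax (q - e) ((p + q) / 2))); [lra|apply Hid; lra].
Qed.

Lemma near_id_cj u k z : homeo k -> near_id u z -> near_id (cj u k) (k z).
Proof.
  intros Hk (e & He & H).
  apply near_id_open with (k (z - e)) (k (z + e)).
  - rewrite !homeo_lt by auto; lra.
  - intros y Hy; rewrite <- (homeo_Kinv k y) in Hy |- * by auto.
    rewrite !homeo_lt in Hy by auto.
    apply cj_fix; auto; apply H; lra.
Qed.

Lemma near_id_inv u z : homeo u -> near_id u z -> near_id (inv u) z.
Proof. intros Hu (e & He & H); exists e; split; auto; intros; apply inv_fix; auto. Qed.

Lemma near_id_comp u v z : near_id u z -> near_id v z -> near_id (fun x => v (u x)) z.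
Proof.
  intros (e & He & H) (e' & He' & H'); exists (Rmin e e'); split; [apply Rmin_glb_lt; auto|].
  intros y Hy; pose proof (Rmin_l e e'); pose proof (Rmin_r e e').
  rewrite H, H'; lra.
Qed.

Lemma pos_lower_bound (l : list R) : (forall x, In x l -> 0 < x) ->
  exists d, 0 < d /\ forall x, In x l -> d <= x.
Proof.
  induction l as [|a l IH]; intros H; [exists 1; split; [lra|intros x []]|].
  destruct IH as (d & Hd & Hl); [intros; apply H; right; auto|].
  exists (Rmin a d); split; [apply Rmin_glb_lt; auto; apply H; left; auto|].
  intros x [<-|Hx]; [apply Rmin_l|].
  apply Rle_trans with d; auto; apply Rmin_r.
Qed.

(* Two linear germs at a common fixed point commute. *)
Lemma comm_near_id f g z : PLo f -> PLo g -> homeo f -> homeo g ->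
  f z = z -> g z = z -> near_id (comm f g) z.
Proof.
  intros Pf Pg Hf Hg Fz Gz.
  destruct (PLo_germ_right f z Pf) as (e1 & a1 & He1 & H1).
  destruct (PLo_germ_right g z Pg) as (e2 & a2 & He2 & H2).
  destruct (PLo_germ_left f z Pf) as (e3 & a3 & He3 & H3).
  destruct (PLo_germ_left g z Pg) as (e4 & a4 & He4 & H4).
  (* [d] keeps the displacement [a * s] of one germ inside the range [e] on which the other germ is
     linear. *)
  assert (Hd : forall e a, 0 < e -> exists d, 0 < d /\ forall s, 0 <= s <= d -> a * s <= e).
  { intros e a He; destruct (Rle_lt_dec a 0) as [Ha|Ha].
    - exists 1; split; [lra|]; intros s Hs.
      assert (0 <= (- a) * s) by (apply Rmult_le_pos; lra); lra.
    - exists (e / a); split; [apply Rdiv_lt_0_compat; auto|]; intros s Hs.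
      replace e with (a * (e / a)) by (field; lra); apply Rmult_le_compat_l; lra. }
  destruct (Hd e2 a1 He2) as (d1 & Hd1 & K1).
  destruct (Hd e1 a2 He1) as (d2 & Hd2 & K2).
  destruct (Hd e4 a3 He4) as (d3 & Hd3 & K3).
  destruct (Hd e3 a4 He3) as (d4 & Hd4 & K4).
  destruct (pos_lower_bound (e1 :: e2 :: e3 :: e4 :: d1 :: d2 :: d3 :: d4 :: nil))
    as (d & Hd0 & Hmin); [simpl; intuition (subst; auto)|].
  assert (d <= e1 /\ d <= e2 /\ d <= e3 /\ d <= e4 /\ d <= d1 /\ d <= d2 /\ d <= d3 /\ d <= d4)
    as (? & ? & ? & ? & ? & ? & ? & ?) by (repeat split; apply Hmin; simpl; tauto).
  assert (C : forall w, z - d <= w <= z + d -> g (f w) = f (g w)).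
  { assert (Pos : forall h s, homeo h -> h z = z -> 0 <= s -> z <= h (z + s) /\ h (z - s) <= z).
    { intros h s Hh Hz Hs; split; rewrite <- Hz at 1; [|rewrite <- Hz at 2];
        apply homeo_le; auto; lra. }
    intros w Hw; destruct (Rle_lt_dec z w).
    - replace w with (z + (w - z)) by ring; set (s := w - z).
      assert (Hs : 0 <= s <= d) by (unfold s; lra).
      pose proof (Pos f s Hf Fz (proj1 Hs)) as [Pf' _].
      pose proof (Pos g s Hg Gz (proj1 Hs)) as [Pg' _].
      rewrite H1, Fz in Pf' by lra; rewrite H2, Gz in Pg' by lra.
      pose proof (K1 s); pose proof (K2 s).
      rewrite (H1 s), (H2 s), Fz, Gz, H1, H2, Fz, Gz by lra; ring.
    - replace w with (z - (z - w)) by ring; set (s := z - w).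
      assert (Hs : 0 <= s <= d) by (unfold s; lra).
      pose proof (Pos f s Hf Fz (proj1 Hs)) as [_ Pf'].
      pose proof (Pos g s Hg Gz (proj1 Hs)) as [_ Pg'].
      rewrite H3, Fz in Pf' by lra; rewrite H4, Gz in Pg' by lra.
      pose proof (K3 s); pose proof (K4 s).
      rewrite (H3 s), (H4 s), Fz, Gz, H3, H4, Fz, Gz by lra; ring. }
  (* Every [y] in this neighbourhood is [f (g w)] with [w] within [d] of [z], where [f] and [g]
     commute. *)
  apply near_id_open with (f (g (z - d))) (f (g (z + d))).
  - rewrite <- Fz at 2 3; rewrite <- Gz at 2 3; rewrite !homeo_lt by auto; lra.
  - intros y Hy; unfold comm; set (w := inv g (inv f y)).
    assert (Ey : y = f (g w)) by (unfold w; rewrite !homeo_Kinv; auto).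
    rewrite Ey in Hy; rewrite !homeo_lt in Hy by auto.
    rewrite C by lra; auto.
Qed.

(** * Operations inside a subgroup *)

Lemma sg_homeo H h : subgroup_PLo H -> H h -> homeo h.
Proof.
  intros (Hp & _ & _ & Hi) Hh; split; [apply PLo_incr; auto|].
  intros y; destruct (Hi h Hh) as (g & _ & _ & Hg); eauto.
Qed.

Lemma sg_PLo H h : subgroup_PLo H -> H h -> PLo h.
Proof. intros (Hp & _) Hh; auto. Qed.

Lemma sg_inv H h : subgroup_PLo H -> H h -> H (inv h).
Proof.
  intros HH Hh; pose proof HH as (_ & _ & _ & Hi); destruct (Hi h Hh) as (g & Hg & _ & E).
  rewrite (inv_unique h g); auto; eapply sg_homeo; eauto.
Qed.

Lemma sg_mul H f g : subgroup_PLo H -> H f -> H g -> H (fun x => g (f x)).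
Proof. intros (_ & _ & Hm & _); auto. Qed.

Lemma sg_pw H h n : subgroup_PLo H -> H h -> H (pw h n).
Proof.
  intros HH Hh; induction n; [exact (proj1 (proj2 HH))|exact (sg_mul H (pw h n) h HH IHn Hh)].
Qed.

Lemma sg_cj H w k : subgroup_PLo H -> H w -> H k -> H (cj w k).
Proof.
  intros HH Hw Hk.
  exact (sg_mul H (inv k) (fun x => k (w x)) HH (sg_inv H k HH Hk) (sg_mul H w k HH Hw Hk)).
Qed.

Lemma sg_comm H f g : subgroup_PLo H -> H f -> H g -> H (comm f g).
Proof.
  intros HH Hf Hg.
  exact (sg_mul H (inv f) _ HH (sg_inv H f HH Hf)
           (sg_mul H (inv g) _ HH (sg_inv H g HH Hg) (sg_mul H f g HH Hf Hg))).
Qed.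

Definition local_triv (L : (R -> R) -> Prop) (F : R -> Prop) (u : R -> R) : Prop :=
  L u /\ forall z, F z -> near_id u z.

Lemma sg_local L F : subgroup_PLo L -> subgroup_PLo (local_triv L F).
Proof.
  intros HL; split; [|split; [|split]].
  - intros h [Hh _]; eapply sg_PLo; eauto.
  - split; [apply HL|]; intros z _; exists 1; split; auto; lra.
  - intros g h [Hg Ng] [Hh Nh]; split; [apply sg_mul; auto|].
    intros z Hz; apply near_id_comp; auto.
  - intros g [Hg Ng]; pose proof (sg_homeo L g HL Hg) as Hom.
    exists (inv g); repeat split.
    + apply sg_inv; auto.
    + intros z Hz; apply near_id_inv; auto.
    + intros x; apply homeo_invK; auto.
    + intros x; apply homeo_Kinv; auto.
Qed.

(** * Groups without chains *)

Definition Chain (L : (R -> R) -> Prop) : Prop :=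
  exists x y a b c d, L x /\ L y /\ Orb x a b /\ Orb y c d /\ a < c /\ c < b /\ b < d.

(** A deep tower in terms of the ends of its orbitals: the inclusions are strict, but consecutive
    orbitals may share one end. *)
Definition Deep (L : (R -> R) -> Prop) : Prop :=
  exists (G : nat -> R -> R) (P Q : nat -> R), forall n,
    L (G n) /\ Orb (G n) (P n) (Q n) /\ P n <= P (S n) /\ Q (S n) <= Q n /\
    ~ (P n = P (S n) /\ Q n = Q (S n)).

(* [f, g] moves the inner end o but is trivial near the shared end, which produces a chain. *)
Lemma no_chain_left L f g c o d : subgroup_PLo L -> ~ Chain L -> L f -> L g ->
  Orb f c o -> Orb g c d -> ~ o < d.
Proof.
  intros HL NC Lf Lg Of Og Hod.
  assert (Hf := sg_homeo L f HL Lf).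
  (* After passing to the inverse if necessary, [inv g o] falls inside the orbital [(c, o)] of [f],
     which makes [comm f g] move [o]. *)
  assert (K : exists k, L k /\ Orb k c d /\ inv k o < o).
  { assert (Hg := sg_homeo L g HL Lg); destruct (Orb_sign g c d Hg Og) as [Hs|Hs].
    - exists g; repeat split; auto; try apply Og.
      apply (homeo_lt g); auto; rewrite homeo_Kinv by auto; apply Hs.
      split; [apply Of|auto].
    - exists (inv g); split; [apply sg_inv; auto|split; [apply Orb_inv; auto|]].
      rewrite (inv_unique (inv g) g); auto using homeo_inv.
      + apply Hs; split; [apply Of|auto].
      + intros x; apply homeo_invK; auto. }
  clear g Lg Og; destruct K as (g & Lg & Og & Hlt).
  assert (Hg := sg_homeo L g HL Lg).
  pose proof Of as (Hco & Fc & Fo & Mf); pose proof Og as (_ & Gc & Gd & Mg).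
  assert (Lw := sg_comm L f g HL Lf Lg).
  assert (Hw := sg_homeo L _ HL Lw).
  assert (Mo : comm f g o <> o).
  { unfold comm; rewrite (proj2 (inv_fix f o Hf) Fo); intros E.
    apply (Mf (inv g o)).
    - split; auto; rewrite <- (proj2 (inv_fix g c Hg) Gc); apply homeo_lt; auto using homeo_inv.
    - apply (homeo_inj g); auto; rewrite homeo_Kinv; auto. }
  destruct (near_id_right (comm f g) c) as (e & He & Hid).
  { apply comm_near_id; auto; eapply sg_PLo; eauto. }
  destruct (Orb_exists (comm f g) o) as (p & q & Ow & Hpq); auto.
  { eapply sg_PLo; eauto. }
  apply NC; exists f, (comm f g), c, o, p, q; repeat split; auto; try apply Of; try apply Ow; try lra.
  apply Rlt_le_trans with (Rmin (c + e) o); [apply Rmin_glb_lt; lra|].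
  pose proof (Rmin_l (c + e) o); pose proof (Rmin_r (c + e) o).
  apply (Orb_fix_le _ p q _ o Ow Hpq); [apply Hid; split; [apply Rmin_glb; lra|auto]|auto].
Qed.

(** Mirror image of the case of a shared left end: [comm f g] moves [o] but is trivial near [d], so
    its orbital around [o] overlaps [(o, d)]. *)
Lemma no_chain_right L f g c o d : subgroup_PLo L -> ~ Chain L -> L f -> L g ->
  Orb f o d -> Orb g c d -> ~ c < o.
Proof.
  intros HL NC Lf Lg Of Og Hod.
  assert (Hf := sg_homeo L f HL Lf).
  assert (K : exists k, L k /\ Orb k c d /\ o < inv k o).
  { assert (Hg := sg_homeo L g HL Lg); destruct (Orb_sign g c d Hg Og) as [Hs|Hs].
    - exists (inv g); split; [apply sg_inv; auto|split; [apply Orb_inv; auto|]].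
      rewrite (inv_unique (inv g) g); auto using homeo_inv.
      + apply Hs; split; [auto|apply Of].
      + intros x; apply homeo_invK; auto.
    - exists g; repeat split; auto; try apply Og.
      apply (homeo_lt g); auto; rewrite homeo_Kinv by auto; apply Hs.
      split; [auto|apply Of]. }
  clear g Lg Og; destruct K as (g & Lg & Og & Hlt).
  assert (Hg := sg_homeo L g HL Lg).
  pose proof Of as (Hco & Fo & Fd & Mf); pose proof Og as (_ & Gc & Gd & Mg).
  assert (Lw := sg_comm L f g HL Lf Lg).
  assert (Hw := sg_homeo L _ HL Lw).
  assert (Mo : comm f g o <> o).
  { unfold comm; rewrite (proj2 (inv_fix f o Hf) Fo); intros E.
    apply (Mf (inv g o)).
    - split; auto; rewrite <- (proj2 (inv_fix g d Hg) Gd); apply homeo_lt; auto using homeo_inv.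
    - apply (homeo_inj g); auto; rewrite homeo_Kinv; auto. }
  destruct (near_id_left (comm f g) d) as (e & He & Hid).
  { apply comm_near_id; auto; eapply sg_PLo; eauto. }
  destruct (Orb_exists (comm f g) o) as (p & q & Ow & Hpq); auto.
  { eapply sg_PLo; eauto. }
  apply NC; exists (comm f g), f, p, q, o, d; repeat split; auto; try apply Of; try apply Ow; try lra.
  apply Rle_lt_trans with (Rmax (d - e) o); [|apply Rmax_lub_lt; lra].
  pose proof (Rmax_l (d - e) o); pose proof (Rmax_r (d - e) o).
  apply (Orb_fix_ge _ p q _ o Ow Hpq); [apply Hid; split; [auto|apply Rmax_lub; lra]|auto].
Qed.

(** Every other order of the four ends is an overlap, hence a chain, or has exactly one shared
    end. *)
Lemma no_chain_nested L f g a b c d : subgroup_PLo L -> ~ Chain L -> L f -> L g ->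
  Orb f a b -> Orb g c d -> a < d -> c < b ->
  (a = c /\ b = d) \/ (a < c /\ d < b) \/ (c < a /\ b < d).
Proof.
  intros HL NC Lf Lg Of Og H1 H2.
  pose proof (no_chain_left L f g) as Kl; pose proof (no_chain_left L g f) as Kl'.
  pose proof (no_chain_right L f g) as Kr; pose proof (no_chain_right L g f) as Kr'.
  destruct (Rtotal_order a c) as [Hac|[->|Hac]];
    destruct (Rtotal_order b d) as [Hbd|[->|Hbd]]; auto; exfalso.
  - apply NC; exists f, g, a, b, c, d; auto 10.
  - eapply Kr'; eauto.
  - eapply Kl; eauto.
  - eapply Kl'; eauto.
  - eapply Kr; eauto.
  - apply NC; exists g, f, c, d, a, b; auto 10.
Qed.

(** If [f] moved an end of [(c, d)], its orbital around that end would have to contain [(c, d)] and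
    hence the fixed point [z]. *)
Lemma no_chain_fixed_ends L f g c d z : subgroup_PLo L -> ~ Chain L -> L f -> L g ->
  Orb g c d -> f z = z -> c < z < d -> f c = c /\ f d = d.
Proof.
  intros HL NC Lf Lg Og Fz Hz.
  assert (K : forall t, (t = c \/ t = d) -> f t = t); [|auto].
  intros t Ht; apply NNPP; intros Mt.
  destruct (Orb_exists f t) as (p & q & Of & Hpq);
    [eapply sg_PLo; eauto|eapply sg_homeo; eauto|auto|].
  pose proof Of as (_ & _ & _ & Mf).
  destruct (no_chain_nested L f g p q c d) as [?|[?|?]]; auto; try (destruct Ht; lra).
  apply (Mf z); auto; lra.
Qed.

(** If [f] were not trivial next to [c], an orbital of [f] would start at [c] and stop at or before
    [z], sharing exactly one end with [(c, d)]; likewise at [d]. *)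
Lemma no_chain_trivial_at_ends L f g c d z : subgroup_PLo L -> ~ Chain L -> L f -> L g ->
  Orb g c d -> f z = z -> c < z < d ->
  exists c' d', c < c' /\ c' <= z /\ z <= d' /\ d' < d /\
    (forall t, c <= t <= c' -> f t = t) /\ (forall t, d' <= t <= d -> f t = t).
Proof.
  intros HL NC Lf Lg Og Fz Hz.
  destruct (no_chain_fixed_ends L f g c d z) as [Fc Fd]; auto.
  assert (Pf := sg_PLo L f HL Lf); assert (Hf := sg_homeo L f HL Lf).
  destruct (germ_right_cases f c Pf Hf Fc) as [(e & He & Hid)|[o Of]].
  2: { exfalso; apply (no_chain_left L f g c o d); auto.
       apply Rle_lt_trans with z; [|lra]; apply Rnot_lt_le; intros Hlt.
       apply (proj2 (proj2 (proj2 Of)) z); auto; lra. }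
  destruct (germ_left_cases f d Pf Hf Fd) as [(e' & He' & Hid')|[o Of]].
  2: { exfalso; apply (no_chain_right L f g c o d); auto.
       apply Rlt_le_trans with z; [lra|]; apply Rnot_lt_le; intros Hlt.
       apply (proj2 (proj2 (proj2 Of)) z); auto; lra. }
  pose proof (Rmin_l (c + e) z); pose proof (Rmin_r (c + e) z).
  pose proof (Rmax_l (d - e') z); pose proof (Rmax_r (d - e') z).
  exists (Rmin (c + e) z), (Rmax (d - e') z); repeat split; auto.
  - apply Rmin_glb_lt; lra.
  - apply Rmax_lub_lt; lra.
  - intros t Ht; apply Hid; lra.
  - intros t Ht; apply Hid'; lra.
Qed.

(** Both maps preserve [(c, d)] and have disjoint supports in it, so they commute there. *)
Lemma comm_disjoint F K c d y : homeo F -> homeo K ->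
  F c = c -> F d = d -> K c = c -> K d = d ->
  (forall t, c < t < d -> F t = t \/ K t = t) -> c < y < d -> comm F K y = y.
Proof.
  intros HF HK Fc Fd Kc Kd Hdis Hy; unfold comm.
  assert (S : forall h, homeo h -> h c = c -> h d = d -> forall t, c < t < d -> c < inv h t < d).
  { intros h Hh Ec Ed t Ht; apply homeo_stable; auto using homeo_inv; apply inv_fix; auto. }
  assert (I : forall h t, homeo h -> h (inv h t) = inv h t -> inv h t = t).
  { intros h t Hh E; rewrite homeo_Kinv in E; auto. }
  destruct (Hdis y Hy) as [E|E].
  - rewrite (proj2 (inv_fix F y HF) E).
    destruct (Hdis (inv K y)) as [E'|E']; [apply S; auto|rewrite E'; apply homeo_Kinv; auto|].
    rewrite (I K y HK E'), E, <- (I K y HK E') at 1; apply homeo_Kinv; auto.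
  - destruct (Hdis (inv F y)) as [E'|E']; [apply S; auto| |].
    + rewrite (I F y HF E'), (proj2 (inv_fix K y HK) E).
      rewrite <- (I F y HF E') at 1; rewrite homeo_Kinv; auto.
    + rewrite (proj2 (inv_fix K _ HK) E'), homeo_Kinv; auto.
Qed.

(* With F a power of f displacing the support of g inside (A, B), and G a large power of g,
   the element [F, F^G] is G on (P, Q); on an orbital of g that meets Fix f the supports of
   F and F^G are disjoint, so it vanishes there. *)
Lemma no_chain_localize L f g A B P Q : subgroup_PLo L -> ~ Chain L -> L f -> L g ->
  Orb f A B -> Orb g P Q -> A < P -> Q < B ->
  exists x, local_triv L (fun z => f z = z) x /\ Orb x P Q.
Proof.
  intros HL NC Lf Lg Of Og HAP HQB.
  assert (Pg := sg_PLo L g HL Lg); assert (Hg := sg_homeo L g HL Lg).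
  assert (Pf := sg_PLo L f HL Lf); assert (Hf := sg_homeo L f HL Lf).
  pose proof Og as (HPQ & GP & GQ & Mg).
  destruct (no_chain_fixed_ends L g f A B P) as [GA GB]; auto; [lra|].
  destruct (no_chain_trivial_at_ends L g f A B P) as (s1 & s2 & Hs1 & Hs1P & HPs2 & Hs2 & T1 & T2);
    auto; [lra|].
  assert (HQs2 : Q <= s2).
  { apply Rnot_lt_le; intros Hlt; apply (Mg ((s2 + Q) / 2)); [lra|apply T2; lra]. }
  (* [[s1, s2]] holds the support of [g] in [(A, B)], and all powers of [f] from [M] on carry it off
     itself. *)
  destruct (displace f A B s1 s2 s1 s2) as [M HM]; auto; try lra.
  set (F := pw f (S M)); assert (EF : F = pw f (S M)) by auto; clearbody F.
  assert (LF : L F) by (rewrite EF; apply sg_pw; auto).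
  assert (HF : homeo F) by (rewrite EF; apply homeo_pw; auto).
  assert (FixF : forall t, F t = t <-> f t = t) by (intros t; rewrite EF; apply pw_fix_iff; auto; lia).
  destruct (PLo_orbitals_finite g Pg Hg) as (l & Hl & Hl').
  (* On an orbital of [g] that meets the fixed set of [f], [f] is trivial near both ends, so a high
     power of [g] carries the support of [f] there off itself. *)
  destruct (list_uniform l (fun I k => (1 <= k)%nat -> forall z, f z = z -> fst I < z < snd I ->
     f (fst I) = fst I /\ f (snd I) = snd I /\
     forall y, fst I < y < snd I -> f y = y \/ f (inv (pw g k) y) = inv (pw g k) y)) as [k Hk].
  { intros [c d] Hcd; apply Hl in Hcd; simpl.
    destruct (classic (exists z, f z = z /\ c < z < d)) as [(z & Fz & Hz)|Hn];
      [|exists 0%nat; intros; exfalso; eauto].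
    destruct (no_chain_trivial_at_ends L f g c d z) as (c' & d' & K1 & K2 & K3 & K4 & T3 & T4); auto.
    destruct (displace g c d c' d' c' d') as [N HN]; auto; try lra.
    exists N; intros k Hk Hk1 _ _ _; split; [apply T3; lra|split; [apply T4; lra|]].
    intros y Hy; apply NNPP; intros Hne; apply not_or_and in Hne; destruct Hne as [N1 N2].
    assert (Hom : homeo (pw g k)) by (apply homeo_pw; auto).
    assert (Hin : forall t, c < t < d -> f t <> t -> c' <= t <= d').
    { intros t Ht Hne; split; apply Rnot_lt_le; intros Hlt; apply Hne;
        [apply T3|apply T4]; lra. }
    apply (HN k Hk (inv (pw g k) y)).
    - apply Hin; auto; apply homeo_stable; auto using homeo_inv;
        apply inv_fix; auto; apply pw_fix; apply Hcd.
    - rewrite homeo_Kinv by auto; auto. }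
  specialize (Hk (S k) (le_S _ _ (le_n k))).
  set (G := pw g (S k)) in *; assert (EG : G = pw g (S k)) by auto; clearbody G.
  assert (FixG : forall t, G t = t <-> g t = t) by (intros t; rewrite EG; apply pw_fix_iff; auto; lia).
  assert (LG : L G) by (rewrite EG; apply sg_pw; auto).
  assert (HG : homeo G) by (rewrite EG; apply homeo_pw; auto).
  assert (LK : L (cj F G)) by (apply sg_cj; auto).
  assert (HK : homeo (cj F G)) by (apply homeo_cj; auto).
  assert (FixK : forall t, cj F G t = t <-> f (inv G t) = inv G t).
  { intros t; rewrite <- FixF, <- (cj_fix F G) by auto; rewrite homeo_Kinv by auto; tauto. }
  exists (comm F (cj F G)); split; [split; [apply sg_comm; auto|]|].
  - intros z Fz; destruct (Req_dec (g z) z) as [Gz|Gz].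
    + apply comm_near_id; auto; try solve [eapply sg_PLo; eauto].
      * apply FixF; auto.
      * apply FixK; rewrite (proj2 (inv_fix G z HG)); auto; apply FixG; auto.
    + destruct (Hl' z Gz) as (c & d & Hcd & Hz).
      destruct (Hk (c, d) Hcd ltac:(lia) z Fz Hz) as (Fc & Fd & Hdis); simpl in *.
      pose proof (Hl c d Hcd) as (_ & Gc & Gd & _).
      apply near_id_open with c d; auto; intros y Hy.
      assert (IG : forall t, g t = t -> inv G t = t)
        by (intros t Ht; apply inv_fix; auto; apply FixG; auto).
      apply (comm_disjoint F (cj F G) c d); auto; try (apply FixF; auto);
        try (apply FixK; rewrite IG; auto).
      intros t Ht; rewrite FixF, FixK; auto.
  - assert (Out : forall t, A < t < B -> ~ s1 <= t <= s2 -> inv G t = t).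
    { intros t Ht Hne; apply inv_fix; auto; apply FixG.
      destruct (Rlt_le_dec t s1); [apply T1|apply T2]; lra. }
    assert (In' : forall t, A < t < B -> A < inv F t < B).
    { intros t Ht; apply homeo_stable; auto using homeo_inv; apply inv_fix; auto;
        apply FixF; apply Of. }
    (* [G] fixes [inv F y] and [inv F (inv F y)], which lie outside [[s1, s2]]; everything in the
       commutator cancels except the outermost [G]. *)
    assert (E : forall y, P <= y <= Q -> comm F (cj F G) y = G y).
    { intros y Hy; unfold comm.
      assert (O1 : ~ s1 <= inv F y <= s2).
      { intros Hc; apply (HM (S M) ltac:(lia) (inv F y) Hc).
        rewrite <- EF, homeo_Kinv by auto; lra. }
      assert (O2 : ~ s1 <= inv F (inv F y) <= s2).
      { intros Hc; apply (HM (S M + S M)%nat ltac:(lia) _ Hc); rewrite pw_add, <- EF, !homeo_Kinv by auto; lra. }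
      assert (I1 : A < inv F y < B) by (apply In'; lra).
      rewrite inv_cj by auto; unfold cj at 2; rewrite Out by auto.
      rewrite <- (Out (inv F (inv F y))) at 1 by auto.
      rewrite (homeo_Kinv G), (homeo_Kinv F) by auto.
      unfold cj; rewrite Out, homeo_Kinv by auto; auto. }
    split; [auto|split; [|split]].
    + rewrite E by lra; apply FixG; auto.
    + rewrite E by lra; apply FixG; auto.
    + intros z Hz; rewrite E, FixG by lra; apply Mg; auto.
Qed.

Lemma Deep_strict L (G : nat -> R -> R) (P Q : nat -> R) : subgroup_PLo L -> ~ Chain L ->
  (forall n, L (G n) /\ Orb (G n) (P n) (Q n) /\ P n <= P (S n) /\ Q (S n) <= Q n /\
    ~ (P n = P (S n) /\ Q n = Q (S n))) ->
  forall n, P 0%nat < P (S n) /\ Q (S n) < Q 0%nat.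
Proof.
  intros HL NC H.
  assert (K : forall n, P n < P (S n) /\ Q (S n) < Q n).
  { intros n; destruct (H n) as (L1 & O1 & Hp & Hq & Hne); destruct (H (S n)) as (L2 & O2 & _).
    pose proof (proj1 O2).
    destruct (no_chain_nested L (G n) (G (S n)) (P n) (Q n) (P (S n)) (Q (S n)))
      as [?|[?|?]]; auto; lra. }
  induction n; [apply K|]; specialize (K (S n)); lra.
Qed.

(** [h] is the top element [G 0]; localization replaces each later element by one that is trivial
    near the fixed points of [h] and has the same orbital. *)
Lemma no_chain_step L : subgroup_PLo L -> ~ Chain L -> Deep L ->
  exists h, L h /\ Deep (local_triv L (fun z => h z = z)).
Proof.
  intros HL NC (G & P & Q & H).
  pose proof (Deep_strict L G P Q HL NC H) as Hs.
  exists (G 0%nat); split; [apply H|].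
  assert (K : forall n, exists x, local_triv L (fun z => G 0%nat z = z) x /\ Orb x (P (S n)) (Q (S n))).
  { intros n; apply (no_chain_localize L (G 0%nat) (G (S n)) (P 0%nat) (Q 0%nat)); auto;
      try apply H; apply Hs. }
  destruct (choose _ K) as [X HX].
  exists X, (fun n => P (S n)), (fun n => Q (S n)); intros n.
  split; [apply HX|split; [apply HX|apply H]].
Qed.

(** * Deep towers produced by a chain *)

Lemma local_triv_cj H F u k : subgroup_PLo H -> H k -> (forall z, F z -> F (inv k z)) ->
  local_triv H F u -> local_triv H F (cj u k).
Proof.
  intros HH Hk HF [Hu Nu]; split; [apply sg_cj; auto|]; intros z Hz.
  assert (Hom := sg_homeo H k HH Hk).
  rewrite <- (homeo_Kinv k z) by auto; apply near_id_cj; auto.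
Qed.

Fixpoint cj_iter (w k : R -> R) (n : nat) : R -> R :=
  match n with O => w | S m => cj (cj_iter w k m) k end.

(** The conjugates of [w] by powers of [k] have orbitals [(k^n p, k^n q)], which are nested because
    [k] contracts [(p, q)]. *)
Lemma Deep_of_contracted L w k p q : L w -> Orb w p q -> homeo k ->
  (forall u, L u -> L (cj u k)) -> p < k p -> k q < q -> Deep L.
Proof.
  intros Lw Ow Hk Hn Hp Hq.
  exists (cj_iter w k), (fun n => pw k n p), (fun n => pw k n q); intros n.
  assert (K1 : pw k n p < pw k (S n) p).
  { replace (S n) with (n + 1)%nat by lia; rewrite pw_add; apply homeo_lt; auto using homeo_pw. }
  assert (K2 : pw k (S n) q < pw k n q).
  { replace (S n) with (n + 1)%nat by lia; rewrite pw_add; apply homeo_lt; auto using homeo_pw. }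
  split; [induction n; simpl; auto|split; [|lra]].
  - apply Hn, IHn; replace (S n) with (n + 1)%nat by lia; rewrite pw_add; apply homeo_lt; auto using homeo_pw.
  - clear K1 K2; induction n; simpl; auto using Orb_cj.
Qed.

(** The orbital and its image under [k] both contain [z], hence are nested; a strict inclusion
    either way is iterated by [k] or by [inv k]. *)
Lemma Deep_or_invariant L w k p q z : subgroup_PLo L -> ~ Chain L -> L w -> Orb w p q ->
  p < z < q -> homeo k -> k z = z ->
  (forall u, L u -> L (cj u k)) -> (forall u, L u -> L (cj u (inv k))) ->
  Deep L \/ (k p = p /\ k q = q).
Proof.
  intros HL NC Lw Ow Hz Hk Kz N1 N2.
  assert (Ow' := Orb_cj w k p q Hk Ow).
  assert (k p < z < k q) by (rewrite <- Kz; rewrite !homeo_lt by auto; auto).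
  destruct (no_chain_nested L w (cj w k) p q (k p) (k q)) as [?|[[? ?]|[? ?]]]; auto; try lra; left.
  - apply (Deep_of_contracted L w k p q); auto.
  - apply (Deep_of_contracted L w (inv k) p q); auto using homeo_inv;
      apply (homeo_lt k); auto; rewrite homeo_Kinv; auto.
Qed.

(** Let [(p, q)] be the orbital around [b] of a commutator [w] in the group. If no deep tower
    arises, [f] fixes [p], so [p <= a] and [(p, q)] contains [c]; then [g] fixes [p] too, and [w] is
    trivial near the end [p] of its own orbital, which is absurd. *)
Lemma chain_deep H f g a b c d : subgroup_PLo H -> H f -> H g -> Orb f a b -> Orb g c d ->
  a < c -> c < b -> b < d ->
  ~ Chain (local_triv H (fun z => f z = z /\ g z = z)) ->
  Deep (local_triv H (fun z => f z = z /\ g z = z)).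
Proof.
  intros HH Hf Hg Of Og Hac Hcb Hbd; set (L := local_triv H _); intros NC.
  assert (HL : subgroup_PLo L) by (apply sg_local; auto).
  assert (Homf := sg_homeo H f HH Hf); assert (Homg := sg_homeo H g HH Hg).
  pose proof Of as (_ & Fa & Fb & Mf); pose proof Og as (_ & Gc & Gd & Mg).
  assert (W : exists w, L w /\ w b <> b).
  { assert (K : exists k, H k /\ Orb k c d /\ (forall z, k z = z <-> g z = z) /\ inv k b < b).
    { destruct (Orb_sign g c d Homg Og) as [Hs|Hs].
      - exists g; repeat split; auto; try apply Og.
        apply (homeo_lt g); auto; rewrite homeo_Kinv by auto; apply Hs; lra.
      - exists (inv g); split; [apply sg_inv; auto|split; [apply Orb_inv; auto|]].
        split; [intros; apply inv_fix; auto|].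
        rewrite (inv_unique (inv g) g); auto using homeo_inv.
        intros x; apply homeo_invK; auto. }
    destruct K as (k & Hk & (_ & Kc & Kd & Mk) & Fk & Hlt).
    assert (Homk := sg_homeo H k HH Hk).
    exists (comm f k); split; [split; [apply sg_comm; auto|]|].
    - intros z [Fz Gz]; apply comm_near_id; auto; try solve [apply (sg_PLo H); auto]; apply Fk; auto.
    - unfold comm; rewrite (proj2 (inv_fix f b Homf) Fb); intros E.
      apply (Mf (inv k b)).
      + split; auto; apply Rlt_trans with c; auto.
        rewrite <- (proj2 (inv_fix k c Homk) Kc); apply homeo_lt; auto using homeo_inv.
      + apply (homeo_inj k); auto; rewrite homeo_Kinv; auto. }
  destruct W as (w & Lw & Mw).
  destruct (Orb_exists w b) as (p & q & Ow & Hpq); auto;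
    [apply (sg_PLo L); auto|apply (sg_homeo L); auto|].
  assert (N : forall k, H k -> (forall z, f z = z /\ g z = z -> k z = z) ->
            (forall u, L u -> L (cj u k)) /\ (forall u, L u -> L (cj u (inv k)))).
  { intros k Hk Fk; assert (Homk := sg_homeo H k HH Hk).
    assert (Fk' : forall z, f z = z /\ g z = z -> inv k z = z)
      by (intros z Hz; apply inv_fix; auto).
    split; intros u Hu.
    - refine (local_triv_cj H _ u k HH Hk _ Hu); intros z Hz; rewrite Fk'; auto.
    - refine (local_triv_cj H _ u (inv k) HH (sg_inv H k HH Hk) _ Hu); intros z Hz.
      rewrite (proj2 (inv_fix (inv k) z (homeo_inv k Homk)) (Fk' z Hz)); auto. }
  destruct (N f Hf) as [Nf Nf']; [tauto|]; destruct (N g Hg) as [Ng Ng']; [tauto|].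
  destruct (Deep_or_invariant L w f p q b) as [?|[Fp Fq]]; auto.
  assert (p <= a).
  { apply Rnot_lt_le; intros Hlt; apply (Mf p); auto; lra. }
  destruct (Deep_or_invariant L w g p q c) as [?|[Gp Gq]]; auto; [lra|].
  exfalso; apply (near_id_Orb_left w p q); auto; apply (proj2 Lw); auto.
Qed.

(** * Elements without fixed points on a compact set *)

Definition fix2 (f g : R -> R) (z : R) : Prop := f z = z /\ g z = z.

Definition Comp (f g : R -> R) (u v : R) : Prop :=
  u < v /\ fix2 f g u /\ fix2 f g v /\ forall t, u < t < v -> ~ fix2 f g t.

(** For [f] and [g] in [H] this is a group containing both and preserving every component
    [Comp f g u v]; it replaces the group generated by the two. *)
Definition fixer (H : (R -> R) -> Prop) (f g k : R -> R) : Prop :=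
  H k /\ forall z, fix2 f g z -> k z = z.

(** [Q] stays within a compact part of every component of the complement of the common fixed points,
    so that points can be pushed past it. *)
Definition tame (f g : R -> R) (Q : R -> Prop) : Prop :=
  (forall t, Q t -> ~ fix2 f g t) /\
  forall u v, Comp f g u v -> exists p q, u < p < v /\ u < q < v /\
    forall y, Q y -> u < y < v -> p <= y <= q.

Lemma Comp_exists f g z : PLo f -> homeo f -> PLo g -> homeo g -> ~ fix2 f g z ->
  exists u v, Comp f g u v /\ u < z < v.
Proof.
  intros Pf Hf Pg Hg Hz.
  assert (Hz01 : 0 < z < 1).
  { apply not_and_or in Hz; destruct Hz as [Hz|Hz].
    - apply (PLo_moved_bounds f); auto.
    - apply (PLo_moved_bounds g); auto. }
  pose proof Pf as (_ & F0 & F1 & _); pose proof Pg as (_ & G0 & G1 & _).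
  destruct (closest_fixed_below (fix2 f g) 0 z) as [p [Hp Hp']]; [split; auto|lra|].
  destruct (closest_fixed_below (fix2 (refl f) (refl g)) (- 1) (- z)) as [q [Hq Hq']]; try lra.
  { unfold fix2, refl; replace (- (- 1)) with 1 by ring; split; lra. }
  assert (Fp : fix2 f g p)
    by (split; eapply fixed_lub; try exact Hp; auto; intros t [[? ?] _]; auto).
  assert (Fq : fix2 (refl f) (refl g) q)
    by (split; eapply fixed_lub; try exact Hq; auto using homeo_refl; intros t [[? ?] _]; auto).
  assert (Fq' : fix2 f g (- q)) by (unfold fix2, refl in *; lra).
  assert (p <> z) by (intros ->; auto).
  assert (- q <> z) by (intros E; rewrite E in Fq'; auto).
  exists p, (- q); repeat split; auto; try apply Fp; try apply Fq'; try lra.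
  intros t Ht Et; destruct (Rle_lt_dec t z).
  - assert (t <= p) by (apply Hp; auto); lra.
  - assert (- t <= q); [|lra].
    apply Hq; unfold fix2, refl in *; rewrite Ropp_involutive; lra.
Qed.

Lemma fixer_mul H f g j k : subgroup_PLo H -> fixer H f g j -> fixer H f g k ->
  fixer H f g (fun x => k (j x)).
Proof.
  intros HH [Hj Fj] [Hk Fk]; split; [apply sg_mul; auto|].
  intros z Hz; rewrite Fj, Fk; auto.
Qed.

Lemma fixer_inv H f g j : subgroup_PLo H -> fixer H f g j -> fixer H f g (inv j).
Proof.
  intros HH [Hj Fj]; split; [apply sg_inv; auto|].
  intros z Hz; apply inv_fix; auto; apply (sg_homeo H); auto.
Qed.

Lemma fixer_Comp H f g j u v y : subgroup_PLo H -> fixer H f g j -> Comp f g u v ->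
  u < j y < v <-> u < y < v.
Proof.
  intros HH [Hj Fj] (_ & Fu & Fv & _); assert (Hom := sg_homeo H j HH Hj).
  rewrite <- (Fj u Fu) at 1; rewrite <- (Fj v Fv) at 1; rewrite !homeo_lt by auto; tauto.
Qed.

Lemma fixer_fix2 H f g j y : subgroup_PLo H -> fixer H f g j ->
  fix2 f g (j y) <-> fix2 f g y.
Proof.
  intros HH [Hj Fj]; assert (Hom := sg_homeo H j HH Hj); split; intros Hy.
  - replace y with (j y); auto; apply (homeo_inj j); auto.
  - rewrite Fj; auto.
Qed.

(* The supremum of an orbit of the fixer is a common fixed point. *)
Lemma push_one H f g u v p q : subgroup_PLo H -> H f -> H g -> Comp f g u v ->
  u < p < v -> q < v -> exists j, fixer H f g j /\ q < j p.
Proof.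
  intros HH Hf Hg HC Hp Hq; apply NNPP; intros Hn.
  assert (Hle : forall j, fixer H f g j -> j p <= q)
    by (intros j Hj; apply Rnot_lt_le; intros Hlt; apply Hn; eauto).
  assert (Gid : fixer H f g (fun x => x)) by (split; [apply HH|auto]).
  assert (Gf : fixer H f g f) by (split; auto; intros z Hz; apply Hz).
  assert (Gg : fixer H f g g) by (split; auto; intros z Hz; apply Hz).
  destruct (completeness (fun t => exists j, fixer H f g j /\ t = j p)) as [s Hs].
  - exists q; intros t (j & Hj & ->); auto.
  - exists p, (fun x => x); auto.
  - assert (K : forall k, fixer H f g k -> k s = s).
    { intros k Hk; eapply lub_fixed; try exact Hs.
      - apply (sg_homeo H); auto; apply Hk.
      - intros x (j & Hj & ->); exists (fun x => k (j x)); split; auto; apply fixer_mul; auto.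
      - intros x (j & Hj & ->); exists (fun x => inv k (j x)); split; auto.
        apply fixer_mul; auto; apply fixer_inv; auto. }
    destruct Hs as [Hs Hs']; destruct HC as (_ & _ & _ & HC); apply (HC s).
    + split.
      * apply Rlt_le_trans with p; [lra|]; apply Hs; exists (fun x => x); auto.
      * apply Rle_lt_trans with q; auto; apply Hs'; intros t (j & Hj & ->); auto.
    + split; apply K; auto.
Qed.

Lemma tame_union f g Q1 Q2 : tame f g Q1 -> tame f g Q2 -> tame f g (fun t => Q1 t \/ Q2 t).
Proof.
  intros [N1 T1] [N2 T2]; split; [intros t [?|?]; auto|]; intros u v HC.
  destruct (T1 u v HC) as (p1 & q1 & H1 & H1' & K1); destruct (T2 u v HC) as (p2 & q2 & H2 & H2' & K2).
  exists (Rmin p1 p2), (Rmax q1 q2); repeat split.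
  - apply Rmin_glb_lt; lra.
  - pose proof (Rmin_l p1 p2); lra.
  - pose proof (Rmax_l q1 q2); lra.
  - apply Rmax_lub_lt; lra.
  - destruct H as [H|H]; [apply Rle_trans with p1; [apply Rmin_l|apply K1; auto]|].
    apply Rle_trans with p2; [apply Rmin_r|apply K2; auto].
  - destruct H as [H|H]; [apply Rle_trans with q1; [apply K1; auto|apply Rmax_l]|].
    apply Rle_trans with q2; [apply K2; auto|apply Rmax_r].
Qed.

Lemma tame_preimage H f g Q j : subgroup_PLo H -> fixer H f g j -> tame f g Q ->
  tame f g (fun t => Q (j t)).
Proof.
  intros HH Hj [N T]; split.
  - intros t Ht Ft; apply (N (j t)); auto; apply (fixer_fix2 H f g j); auto.
  - intros u v HC; destruct (T u v HC) as (p & q & Hp & Hq & K).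
    assert (Hom := sg_homeo H j HH (proj1 Hj)).
    assert (Hij := fixer_inv H f g j HH Hj).
    exists (inv j p), (inv j q).
    split; [|split]; try (apply (fixer_Comp H f g (inv j)); auto).
    intros y Hy Huv; apply (fixer_Comp H f g j) in Huv; auto.
    destruct (K (j y) Hy Huv).
    split; apply (homeo_le j); auto; rewrite homeo_Kinv; auto.
Qed.

Lemma tame_interval f g p q : (forall t, p <= t <= q -> ~ fix2 f g t) ->
  tame f g (fun t => p <= t <= q).
Proof.
  intros Hpq; split; auto; intros u v (Huv & Fu & Fv & _).
  destruct (classic (exists y, p <= y <= q /\ u < y < v)) as [(y & Hy & Hy')|Hn].
  - assert (u < p) by (apply Rnot_le_lt; intros Hle; apply (Hpq u); auto; lra).
    assert (q < v) by (apply Rnot_le_lt; intros Hle; apply (Hpq v); auto; lra).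
    exists p, q; repeat split; lra.
  - exists ((u + v) / 2), ((u + v) / 2); split; [lra|split; [lra|]].
    intros y Hy Hy'; exfalso; eauto.
Qed.

Definition covers (l : list (R * R)) (t : R) : Prop := exists p q, In (p, q) l /\ p <= t <= q.

Lemma tame_list f g l : (forall t, covers l t -> ~ fix2 f g t) -> tame f g (covers l).
Proof.
  induction l as [|[p q] l IH]; intros Hl.
  - split; auto; intros u v (Huv & _); exists ((u + v) / 2), ((u + v) / 2).
    split; [lra|split; [lra|intros y (p & q & [] & _)]].
  - assert (E : covers ((p, q) :: l) = fun t => p <= t <= q \/ covers l t).
    { apply functional_extensionality; intros t; apply propositional_extensionality.
      unfold covers; simpl; split.
      - intros (p' & q' & [E|Hin] & Ht); [inversion E; subst; auto|right; eauto].
      - intros [Ht|(p' & q' & Hin & Ht)]; eauto 6. }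
    rewrite E in *; apply tame_union; [apply tame_interval; auto|apply IH; auto].
Qed.

(** Induction on the points to be moved: if [k z] still lies in [Q], a further [j] pushes it beyond
    the part of [Q] in its component. *)
Lemma push H f g Z : subgroup_PLo H -> H f -> H g -> forall Q, tame f g Q ->
  exists k, fixer H f g k /\ forall z, In z Z -> ~ Q (k z).
Proof.
  intros HH Hf Hg; induction Z as [|z Z IH]; intros Q HQ.
  - exists (fun x => x); split; [split; [apply HH|auto]|intros z []].
  - destruct (classic (fix2 f g z)) as [Fz|Fz].
    { destruct (IH Q HQ) as (k & Hk & Kk); exists k; split; auto.
      intros t [<-|Ht]; auto; intros Hc; apply (proj1 HQ) in Hc.
      rewrite (proj2 Hk z Fz) in Hc; auto. }
    destruct (Comp_exists f g z) as (u & v & HC & Huv); auto;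
      try (apply (sg_PLo H); auto); try (apply (sg_homeo H); auto).
    destruct (proj2 HQ u v HC) as (p & q & Hp & Hq & HB).
    destruct (push_one H f g u v p q) as (j & Hj & Hjp); auto; [lra|].
    (* Avoiding the preimage of [Q] under [j] as well keeps the other points off [Q] after [j] is
       applied. *)
    destruct (IH (fun t => Q t \/ Q (j t))) as (k & Hk & Kk).
    { apply tame_union; auto; apply (tame_preimage H); auto. }
    destruct (classic (Q (k z))) as [Qz|Qz].
    + exists (fun x => j (k x)); split; [apply fixer_mul; auto|].
      intros t [<-|Ht] Hc; [|apply (Kk t Ht); auto].
      assert (Hkz : u < k z < v) by (apply (fixer_Comp H f g k); auto).
      assert (Hjkz : u < j (k z) < v) by (apply (fixer_Comp H f g j); auto).
      pose proof (HB _ Qz Hkz) as [B1 _]; pose proof (HB _ Hc Hjkz) as [_ B2].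
      apply (homeo_le j) in B1; [lra|apply (sg_homeo H); auto; apply Hj].
    + exists k; split; auto; intros t [<-|Ht] Hc; [auto|apply (Kk t Ht); auto].
Qed.

(** An orbital of the conjugate that meets [[p, q]] has no end in it and so contains it. *)
Lemma pure_on_interval w k l p q : homeo k -> (forall a b, In (a, b) l -> Orb w a b) ->
  (forall z, w z <> z -> exists a b, In (a, b) l /\ a < z < b) ->
  (forall a b, In (a, b) l -> ~ p <= k a <= q /\ ~ p <= k b <= q) ->
  (forall t, p <= t <= q -> cj w k t = t) \/ exists a b, Orb (cj w k) a b /\ a < p /\ q < b.
Proof.
  intros Hk Hl Hl' Hout.
  destruct (classic (exists t, p <= t <= q /\ cj w k t <> t)) as [(t & Ht & Mt)|Hn].
  - right; rewrite <- (homeo_Kinv k t) in Mt by auto; rewrite cj_fix in Mt by auto.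
    destruct (Hl' _ Mt) as (a & b & Hin & Ha & Hb).
    exists (k a), (k b); split; [apply Orb_cj; auto|].
    apply (homeo_lt k) in Ha; apply (homeo_lt k) in Hb; auto; rewrite homeo_Kinv in * by auto.
    destruct (Hout a b Hin); lra.
  - left; intros t Ht; apply NNPP; eauto.
Qed.

(** The orbital ending first on the right decides. If [b < d], a power of [g] brings [b] below [p];
    otherwise a power of [f] takes [p] beyond the preimage [X] of [q] under the given power of
    [g]. *)
Lemma opposite_large_powers f g a b c d p q : homeo f -> homeo g -> Orb f a b -> Orb g c d ->
  a < p -> c < p -> p <= q -> q < b -> q < d ->
  (forall x, a < x < b -> x < f x) -> (forall x, c < x < d -> g x < x) ->
  exists M0, forall M, (M0 <= M)%nat -> exists N0, forall N, (N0 <= N)%nat ->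
    forall t, p <= t <= q -> pw g M (pw f N t) <> t.
Proof.
  intros Hf Hg Of Og H1 H2 H3 H4 H5 Sf Sg.
  assert (Fb : f b = b) by apply Of.
  destruct (Rlt_le_dec b d) as [Hbd|Hbd].
  - destruct (escape_left g c d b p) as [M0 HM]; auto; try lra; [apply Sg; lra|].
    exists M0; intros M HM0; specialize (HM M HM0); exists 0%nat; intros N _ t Ht E.
    assert (pw f N t < b).
    { rewrite <- (pw_fix f N b Fb); apply homeo_lt; auto using homeo_pw; lra. }
    pose proof (proj2 (homeo_lt _ (pw f N t) b (homeo_pw g M Hg)) H); lra.
  - exists 0%nat; intros M _; assert (HgM := homeo_pw g M Hg).
    set (X := inv (pw g M) q).
    assert (X < b).
    { apply Rlt_le_trans with d; auto; apply (homeo_lt (pw g M)); auto.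
      unfold X; rewrite homeo_Kinv by auto; rewrite pw_fix; auto; apply Og. }
    destruct (escape_right f a b p X) as [N0 HN]; auto; try lra; [apply Sf; lra|].
    exists N0; intros N HN0 t Ht E; specialize (HN N HN0).
    assert (X < pw f N t).
    { apply Rlt_le_trans with (pw f N p); auto; apply homeo_le; auto using homeo_pw; lra. }
    apply (homeo_lt (pw g M)) in H0; auto; unfold X in H0; rewrite homeo_Kinv in H0 by auto; lra.
Qed.

(** Motions in the same direction cannot cancel; opposite ones reduce, by reflection if necessary,
    to [f] moving up. *)
Lemma large_powers f g a b c d p q : homeo f -> homeo g -> Orb f a b -> Orb g c d ->
  a < p -> c < p -> p <= q -> q < b -> q < d ->
  exists M0, forall M, (M0 <= M)%nat -> exists N0, forall N, (N0 <= N)%nat ->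
    forall t, p <= t <= q -> pw g M (pw f N t) <> t.
Proof.
  intros Hf Hg Of Og H1 H2 H3 H4 H5.
  destruct (Orb_sign f a b Hf Of) as [Sf|Sf]; destruct (Orb_sign g c d Hg Og) as [Sg|Sg].
  - exists 1%nat; intros M HM; exists 1%nat; intros N HN t Ht.
    assert (t < pw f N t) by (apply pw_gt; auto; apply Sf; lra).
    assert (t < pw g M t) by (apply pw_gt; auto; apply Sg; lra).
    apply (homeo_lt (pw g M)) in H; auto using homeo_pw; lra.
  - eapply opposite_large_powers; eauto.
  - destruct (opposite_large_powers (refl f) (refl g) (- b) (- a) (- d) (- c) (- q) (- p))
      as [M0 HM]; auto using homeo_refl, Orb_refl; try lra.
    + intros x Hx; unfold refl; specialize (Sf (- x)); lra.
    + intros x Hx; unfold refl; specialize (Sg (- x)); lra.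
    + exists M0; intros M HM0; destruct (HM M HM0) as [N0 HN]; exists N0; intros N HN0 t Ht E.
      apply (HN N HN0 (- t)); [lra|]; rewrite !pw_refl, !Ropp_involutive; lra.
  - exists 1%nat; intros M HM; exists 1%nat; intros N HN t Ht.
    assert (pw f N t < t) by (apply pw_lt; auto; apply Sf; lra).
    assert (pw g M t < t) by (apply pw_lt; auto; apply Sg; lra).
    apply (homeo_lt (pw g M)) in H; auto using homeo_pw; lra.
Qed.

(* Conjugating by k pushes all ends of orbitals of f and g out of the intervals of l, so on each
   of them both conjugates are trivial or fixed-point free, and not both are trivial. *)
Lemma fixed_point_free_on H f g l : subgroup_PLo H -> H f -> H g ->
  (forall p q, In (p, q) l -> p <= q) -> (forall t, covers l t -> ~ fix2 f g t) ->
  exists h, H h /\ forall t, covers l t -> h t <> t.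
Proof.
  intros HH Hf Hg Hle Hcov.
  assert (Homf := sg_homeo H f HH Hf); assert (Homg := sg_homeo H g HH Hg).
  destruct (PLo_orbitals_finite f) as (lf & Lf & Lf'); [apply (sg_PLo H); auto|auto|].
  destruct (PLo_orbitals_finite g) as (lg & Lg & Lg'); [apply (sg_PLo H); auto|auto|].
  set (ends := fun l : list (R * R) => List.app (List.map fst l) (List.map snd l)).
  destruct (push H f g (List.app (ends lf) (ends lg)) HH Hf Hg (covers l)) as (k & Hk & Kk);
    [apply tame_list; auto|].
  assert (Homk := sg_homeo H k HH (proj1 Hk)).
  assert (Ends : forall lo a b p q, (forall z, In z (ends lo) -> In z (List.app (ends lf) (ends lg))) ->
            In (a, b) lo -> In (p, q) l -> ~ p <= k a <= q /\ ~ p <= k b <= q).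
  { intros lo a b p q Hsub Hin Hpq.
    split; intros Hc; [apply (Kk a)|apply (Kk b)]; try (exists p, q; auto);
      apply Hsub; unfold ends; apply in_or_app.
    - left; change a with (fst (a, b)); apply in_map; auto.
    - right; change b with (snd (a, b)); apply in_map; auto. }
  set (F := cj f k); set (G := cj g k).
  assert (HF : homeo F) by (apply homeo_cj; auto).
  assert (HG : homeo G) by (apply homeo_cj; auto).
  (* [M] is made uniform over [l] first, because the bound on [N] depends on it. *)
  assert (K : exists M, forall p q, In (p, q) l -> exists N0, forall N, (N0 <= N)%nat ->
            forall t, p <= t <= q -> pw G M (pw F N t) <> t).
  { destruct (list_uniform l (fun I M => exists N0, forall N, (N0 <= N)%nat ->
            forall t, fst I <= t <= snd I -> pw G M (pw F N t) <> t)) as [M HM].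
    2: { exists M; intros p q Hpq; apply (HM M (le_n M) (p, q) Hpq). }
    intros [p q] Hpq; simpl; specialize (Hle p q Hpq).
    assert (NF : forall t, p <= t <= q -> ~ (F t = t /\ G t = t)).
    { intros t Ht; rewrite <- (homeo_Kinv k t) by auto; unfold F, G.
      rewrite !cj_fix by auto; intros Hc; apply (Hcov t); [exists p, q; auto|].
      rewrite <- (homeo_Kinv k t) by auto; apply (fixer_fix2 H f g k); auto. }
    destruct (pure_on_interval f k lf p q) as [TF|(a & b & OF & Ha & Hb)]; auto.
    { intros; eapply (Ends lf); eauto; intros; apply in_or_app; auto. }
    - exists 1%nat; intros M HM; exists 1%nat; intros N HN t Ht.
      rewrite (pw_fix F N t) by (apply TF; auto); rewrite pw_fix_iff by auto.
      intros E; apply (NF t Ht); split; auto; apply TF; auto.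
    - destruct (pure_on_interval g k lg p q) as [TG|(c & d & OG & Hc & Hd)]; auto.
      { intros; eapply (Ends lg); eauto; intros; apply in_or_app; auto. }
      + exists 1%nat; intros M HM; exists 1%nat; intros N HN t Ht E.
        rewrite <- (pw_fix G M t) in E at 2 by (apply TG; auto).
        apply homeo_inj in E; [|apply homeo_pw; auto].
        apply (NF t Ht); split; [|apply TG; auto].
        apply (pw_fix_iff F N); auto.
      + apply (large_powers F G a b c d); auto. }
  destruct K as [M HM].
  destruct (list_uniform l (fun I N => forall t, fst I <= t <= snd I -> pw G M (pw F N t) <> t))
    as [N HN].
  { intros [p q] Hpq; apply (HM p q Hpq). }
  exists (fun t => pw G M (pw F N t)); split.
  - apply (sg_mul H (pw F N) (pw G M)); auto; apply sg_pw; auto; apply sg_cj; auto; apply Hk.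
  - intros t (p & q & Hpq & Ht); apply (HN N (le_n N) (p, q) Hpq); auto.
Qed.

(** * The induction step: passing to the elements trivial near a fixed set *)

Lemma near_id_off_orbitals u l z : (forall a b, In (a, b) l -> a < b) ->
  (forall t, u t <> t -> exists a b, In (a, b) l /\ a < t < b) ->
  ~ covers l z -> near_id u z.
Proof.
  intros Hl Hl' Hz.
  assert (K : exists e, 0 < e /\ forall y, z - e < y < z + e -> ~ covers l y).
  { clear Hl'; induction l as [|[a b] l IH].
    - exists 1; split; [lra|]; intros y _ (p & q & [] & _).
    - destruct IH as (e & He & K).
      + intros; apply Hl; right; auto.
      + intros (p & q & Hin & Ht); apply Hz; exists p, q; simpl; auto.
      + assert (Hab : z < a \/ b < z).
        { destruct (Rlt_le_dec z a); auto; destruct (Rlt_le_dec b z); auto.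
          exfalso; apply Hz; exists a, b; simpl; auto. }
        pose proof (Hl a b (or_introl eq_refl)).
        set (e' := if Rlt_dec z a then a - z else z - b).
        assert (0 < e') by (unfold e'; destruct (Rlt_dec z a); lra).
        exists (Rmin e e'); split; [apply Rmin_glb_lt; auto|]; intros y Hy.
        pose proof (Rmin_l e e'); pose proof (Rmin_r e e').
        intros (p & q & [E|Hin] & Ht); [inversion E; subst|apply (K y); [lra|exists p, q; auto]].
        unfold e' in *; destruct (Rlt_dec z p); lra. }
  destruct K as (e & He & K); exists e; split; auto; intros y Hy.
  apply NNPP; intros Hne; destruct (Hl' y Hne) as (a & b & Hin & Hab).
  apply (K y Hy); exists a, b; split; auto; lra.
Qed.

Definition Good (L : (R -> R) -> Prop) : Prop := subgroup_PLo L /\ (Chain L \/ Deep L).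

Lemma Deep_incl (L L' : (R -> R) -> Prop) : (forall u, L u -> L' u) -> Deep L -> Deep L'.
Proof.
  intros Hi (G & P & Q & HG); exists G, P, Q; intros n.
  destruct (HG n) as (H1 & H2); split; auto.
Qed.

(** A common fixed point in a closed orbital of [x] would be an end of it or a moved point, and [x]
    is trivial near neither. *)
Lemma support_cover H f g x : subgroup_PLo H -> local_triv H (fix2 f g) x ->
  exists l, (forall p q, In (p, q) l -> Orb x p q) /\
    (forall z, x z <> z -> exists p q, In (p, q) l /\ p < z < q) /\
    (forall t, covers l t -> ~ fix2 f g t).
Proof.
  intros HH [Hx Nx].
  destruct (PLo_orbitals_finite x) as (l & Hl & Hl');
    [apply (sg_PLo H); auto|apply (sg_homeo H); auto|].
  exists l; split; [auto|split; auto]; intros t (p & q & Hpq & Ht) Ft.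
  specialize (Hl p q Hpq); specialize (Nx t Ft).
  destruct (Req_dec t p) as [->|]; [exact (near_id_Orb_left x p q Nx Hl)|].
  destruct (Req_dec t q) as [->|]; [exact (near_id_Orb_right x p q Nx Hl)|].
  destruct Nx as (e & He & Hid); apply (proj2 (proj2 (proj2 Hl)) t); [lra|apply Hid; lra].
Qed.

Lemma Good_step L : Good L -> exists h, L h /\ Good (local_triv L (fun z => h z = z)).
Proof.
  intros [HL HCD].
  (* An [h] found in a subgroup [L'] without chains also serves [L], because deep towers persist in
     larger groups. *)
  assert (Hdeep : forall L', (forall u, L' u -> L u) -> subgroup_PLo L' -> ~ Chain L' -> Deep L' ->
            exists h, L h /\ Good (local_triv L (fun z => h z = z))).
  { intros L' Hi HL' NC HD; destruct (no_chain_step L' HL' NC HD) as (h & Hh & HDh).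
    exists h; split; auto; split; [apply sg_local; auto|right].
    revert HDh; apply Deep_incl; intros u [Hu Nu]; split; auto. }
  destruct (classic (Chain L)) as [HC|NC];
    [|destruct HCD as [?|HD]; [contradiction|apply (Hdeep L); auto]].
  destruct HC as (f & g & a & b & c & d & Hf & Hg & Of & Og & Hac & Hcb & Hbd).
  set (L' := local_triv L (fix2 f g)).
  assert (HL' : subgroup_PLo L') by (apply sg_local; auto).
  destruct (classic (Chain L')) as [HC|NC].
  2: { apply (Hdeep L'); auto; [intros u Hu; apply Hu|].
       apply (chain_deep L f g a b c d); auto. }
  destruct HC as (x & y & a' & b' & c' & d' & Hx & Hy & Ox & Oy & Hac' & Hcb' & Hbd').
  destruct (support_cover L f g x HL Hx) as (lx & Lx & Lx' & Wx).
  destruct (support_cover L f g y HL Hy) as (ly & Ly & Ly' & Wy).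
  assert (Happ : forall t, covers (lx ++ ly) t <-> covers lx t \/ covers ly t).
  { intros t; unfold covers; split.
    - intros (p & q & Hin & Ht); apply in_app_or in Hin; destruct Hin; eauto 6.
    - intros [(p & q & Hin & Ht)|(p & q & Hin & Ht)]; exists p, q; split; auto;
        apply in_or_app; auto. }
  destruct (fixed_point_free_on L f g (lx ++ ly)) as (h & Hh & Mh); auto.
  { intros p q Hin; apply in_app_or in Hin; destruct Hin as [Hin|Hin];
      [apply Lx in Hin|apply Ly in Hin]; destruct Hin; lra. }
  { intros t Ht; apply Happ in Ht; destruct Ht; auto. }
  (* [h] has no fixed point in the closed orbitals of [x] and [y], so both are trivial near its
     fixed points and their chain survives. *)
  exists h; split; auto; split; [apply sg_local; auto|left].
  exists x, y, a', b', c', d'; repeat split; auto; try apply Ox; try apply Oy;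
    try apply Hx; try apply Hy; intros z Hz.
  - apply (near_id_off_orbitals x lx); auto; [intros p q Hin; apply (Lx p q Hin)|].
    intros Hc; apply (Mh z); auto; apply Happ; auto.
  - apply (near_id_off_orbitals y ly); auto; [intros p q Hin; apply (Ly p q Hin)|].
    intros Hc; apply (Mh z); auto; apply Happ; auto.
Qed.

(** * Deep towers and the nested sequence *)

Lemma orbital_Orb g A : PLo g -> homeo g -> orbital g A ->
  exists p q, Orb g p q /\ A = fun y => p < y < q.
Proof.
  intros Pg Hg (x & [_ Mx] & ->).
  destruct (Orb_exists g x Pg Hg Mx) as (p & q & Ho & Hx).
  pose proof Ho as (Hpq & Fp & Fq & Hm).
  exists p, q; split; auto; apply functional_extensionality; intros y.
  apply propositional_extensionality; split.
  - intros Hy; split; apply Rnot_le_lt; intros Hle.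
    + apply (Hy p); auto; rewrite Rmin_right, Rmax_left; lra.
    + apply (Hy q); auto; rewrite Rmin_left, Rmax_right; lra.
  - intros Hy z Hz.
    assert (Mz : g z <> z).
    { apply Hm; revert Hz; unfold Rmin, Rmax; destruct (Rle_dec x y); lra. }
    split; auto; pose proof (PLo_moved_bounds g z Pg Mz); lra.
Qed.

Lemma interval_incl p q p' q' : p < q ->
  Defs.incl (fun y => p < y < q) (fun y => p' < y < q') -> p' <= p /\ q <= q'.
Proof.
  intros Hpq Hi; split; apply Rnot_lt_le; intros Hlt.
  - destruct (Hi ((p + Rmin p' q) / 2)); unfold Rmin in *; destruct (Rle_dec p' q); lra.
  - destruct (Hi ((Rmax q' p + q) / 2)); unfold Rmax in *; destruct (Rle_dec q' p); lra.
Qed.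

Lemma tower_Deep H : subgroup_PLo H -> admits_deep_tower H -> Deep H.
Proof.
  intros HH (T & (HT & HT') & t & Ht & Hinj & Hinc).
  assert (K : forall n, exists I : R * R, Orb (snd (t n)) (fst I) (snd I) /\
            fst (t n) = fun y => fst I < y < snd I).
  { intros n; destruct (HT (t n) (Ht n)) as [Hs Ho].
    destruct (orbital_Orb _ _ (sg_PLo H _ HH Hs) (sg_homeo H _ HH Hs) Ho) as (p & q & K1 & K2).
    exists (p, q); auto. }
  destruct (choose _ K) as [I HI].
  exists (fun n => snd (t n)), (fun n => fst (I n)), (fun n => snd (I n)); intros n.
  destruct (HI n) as [On En]; destruct (HI (S n)) as [On' En'].
  assert (Hn := Hinc n (S n) (le_S _ _ (le_n n))); rewrite En, En' in Hn.
  apply interval_incl in Hn; [|apply On'].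
  split; [apply HT; auto|split; [auto|split; [apply Hn|split; [apply Hn|]]]].
  intros [E1 E2]; destruct (HT' (t n) (t (S n))) as [Hne _]; auto.
  - intros E; apply Hinj in E; lia.
  - apply Hne; rewrite En, En', E1, E2; auto.
Qed.

Lemma Good_moves L : Good L -> exists u z, L u /\ u z <> z.
Proof.
  intros [_ [(x & y & a & b & c & d & Hx & _ & (Hab & _ & _ & Mx) & _)|(G & P & Q & HG)]].
  - exists x, ((a + b) / 2); split; auto; apply Mx; lra.
  - destruct (HG 0%nat) as (Hx & (Hab & _ & _ & Mx) & _).
    exists (G 0%nat), ((P 0%nat + Q 0%nat) / 2); split; auto; apply Mx; lra.
Qed.

Lemma Good_sequence H : Good H -> exists h : nat -> R -> R,
  (forall n, H (h n)) /\ (forall n, exists z, h n z <> z) /\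
  (forall n z, h n z = z -> near_id (h (S n)) z).
Proof.
  intros GH.
  (* [Good L] sits under the existential so that choice yields a step function defined on every
     [L]. *)
  assert (K : forall L, exists h, Good L -> L h /\ Good (local_triv L (fun z => h z = z))).
  { intros L; destruct (classic (Good L)) as [GL|NG].
    - destruct (Good_step L GL) as [h Hh]; exists h; auto.
    - exists (fun x => x); contradiction. }
  destruct (choose _ K) as [F HF].
  set (Ls := fix Ls n := match n with
        | O => H | S m => local_triv (Ls m) (fun z => F (Ls m) z = z) end).
  assert (GLs : forall n, Good (Ls n)).
  { induction n; [exact GH|]; exact (proj2 (HF (Ls n) IHn)). }
  assert (Hin : forall n u, Ls n u -> H u).
  { induction n; [auto|]; intros u Hu; apply IHn; apply Hu. }
  exists (fun n => F (Ls n)); split; [|split].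
  - intros n; exact (Hin n _ (proj1 (HF (Ls n) (GLs n)))).
  (* Elements of the next group are trivial near the fixed points of [h n], so a point moved by one
     of them is moved by [h n]. *)
  - intros n; destruct (Good_moves (Ls (S n)) (GLs (S n))) as (u & z & [_ Nu] & Mu).
    exists z; intros E; destruct (Nu z E) as (e & He & Hid); apply Mu, Hid; lra.
  - intros n z Hz; exact (proj2 (proj1 (HF (Ls (S n)) (GLs (S n)))) z Hz).
Qed.

(** The closed orbitals of [x] avoid the fixed points of [f], so each lies in one orbital of [f].
    For each of the finitely many pairs, a high power of [f] moves the first off the second if they
    share that orbital, and otherwise they never meet. *)
Lemma displace_support H f x : subgroup_PLo H -> H f -> local_triv H (fun z => f z = z) x ->
  exists N, forall n, (N <= n)%nat -> forall z, x z <> z -> x (pw f n z) = pw f n z.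
Proof.
  intros HH Hf [Hx Nx].
  destruct (support_cover H f f x HH) as (l & Hl & Hl' & Hc).
  { split; auto; intros z [Hz _]; auto. }
  assert (Homf := sg_homeo H f HH Hf); assert (Pf := sg_PLo H f HH Hf).
  assert (Mf : forall p q t, In (p, q) l -> p <= t <= q -> f t <> t).
  { intros p q t Hin Ht E; apply (Hc t); [exists p, q; auto|split; auto]. }
  destruct (list_uniform (list_prod l l) (fun IJ n => forall z, fst (fst IJ) < z < snd (fst IJ) ->
     ~ fst (snd IJ) < pw f n z < snd (snd IJ))) as [N HN].
  { intros [[p q] [p' q']] Hin; apply in_prod_iff in Hin; destruct Hin as [H1 H2]; simpl.
    pose proof (proj1 (Hl p q H1)); pose proof (proj1 (Hl p' q' H2)).
    destruct (Orb_exists f p Pf Homf) as (a & b & Of & Hab); [apply (Mf p q); auto; lra|].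
    pose proof Of as (_ & Fa & Fb & _).
    assert (q < b).
    { apply Rnot_le_lt; intros Hle; apply (Mf p q b H1); auto; lra. }
    destruct (classic (a < p' < b)) as [Hp'|Hp'].
    - assert (q' < b).
      { apply Rnot_le_lt; intros Hle; apply (Mf p' q' b H2); auto; lra. }
      destruct (displace f a b p q p' q') as [N HN]; auto; try lra.
      exists N; intros n Hn z Hz Hc'; apply (HN n Hn z); lra.
    - exists 0%nat; intros n _ z Hz Hc'.
      assert (a < pw f n z < b).
      { apply homeo_stable; [apply homeo_pw; auto| | |lra]; apply pw_fix; auto. }
      apply (Mf p' q' a H2); auto.
      destruct (Rle_lt_dec p' a); [lra|]; exfalso; apply Hp'; lra. }
  exists N; intros n Hn z Mz; apply NNPP; intros Mz'.
  destruct (Hl' z Mz) as (p & q & H1 & Hz); destruct (Hl' _ Mz') as (p' & q' & H2 & Hz').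
  apply (HN n Hn ((p, q), (p', q')) (in_prod l l _ _ H1 H2) z Hz Hz').
Qed.

(* One of the two exponents is 0. *)
Definition zp (h : R -> R) (d : Z) (x : R) : R :=
  pw h (Z.to_nat d) (pw (inv h) (Z.to_nat (- d)) x).

Lemma zp_succ h d x : homeo h -> zp h (Z.succ d) x = h (zp h d x).
Proof.
  intros Hh; unfold zp; destruct (Z_lt_le_dec d 0).
  - replace (Z.to_nat d) with 0%nat by lia.
    replace (Z.to_nat (Z.succ d)) with 0%nat by lia.
    replace (Z.to_nat (- d)) with (S (Z.to_nat (- Z.succ d))) by lia.
    simpl; rewrite homeo_Kinv; auto.
  - replace (Z.to_nat (- d)) with 0%nat by lia.
    replace (Z.to_nat (- Z.succ d)) with 0%nat by lia.
    replace (Z.to_nat (Z.succ d)) with (S (Z.to_nat d)) by lia; auto.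
Qed.

Lemma zp_add h a b x : homeo h -> zp h (a + b) x = zp h a (zp h b x).
Proof.
  intros Hh; induction a as [|a IH|a IH] using Z.peano_ind; [auto| |].
  - rewrite Z.add_succ_l, !zp_succ, IH; auto.
  - apply (homeo_inj h); auto; rewrite <- !zp_succ by auto.
    rewrite Z.add_pred_l, !Z.succ_pred; auto.
Qed.

Lemma zp_fix h d x : homeo h -> h x = x -> zp h d x = x.
Proof.
  intros Hh Hx; unfold zp; rewrite (pw_fix (inv h)) by (apply inv_fix; auto).
  apply pw_fix; auto.
Qed.

Lemma homeo_zp h d : homeo h -> homeo (zp h d).
Proof.
  intros Hh; apply (homeo_comp (pw (inv h) (Z.to_nat (- d))) (pw h (Z.to_nat d)));
    apply homeo_pw; auto using homeo_inv.
Qed.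

Lemma zp_moved h d x : homeo h -> h (zp h d x) = zp h d x <-> h x = x.
Proof.
  intros Hh; rewrite <- zp_succ, <- Z.add_1_r, zp_add by auto.
  replace (zp h 1 x) with (h x) by auto; split; intros E; [|congruence].
  apply (homeo_inj (zp h d)); auto using homeo_zp.
Qed.

Lemma sg_zp H h d : subgroup_PLo H -> H h -> H (zp h d).
Proof.
  intros HH Hh; apply (sg_mul H (pw (inv h) (Z.to_nat (- d))) (pw h (Z.to_nat d)));
    auto; apply sg_pw; auto; apply sg_inv; auto.
Qed.

(** The second clause allows addresses to be truncated; the third makes them unique. *)
Definition nested (e : nat -> R -> R) : Prop :=
  (forall k, homeo (e k)) /\
  (forall k z, e (S k) z <> z -> e k z <> z) /\
  (forall k d z, e (S k) z <> z -> d <> 0%Z -> e (S k) (zp (e k) d z) = zp (e k) d z).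

Lemma Good_nested H : Good H -> exists e, nested e /\
  (forall k, H (e k)) /\ (forall k, exists z, e k z <> z).
Proof.
  intros GH; pose proof (proj1 GH) as HH; destruct (Good_sequence H GH) as (h & Hh & Mh & Nh).
  destruct (choose (fun k N => forall n, (N <= n)%nat -> forall z, h (S k) z <> z ->
     h (S k) (pw (h k) n z) = pw (h k) n z)) as [N HN].
  { intros k; apply (displace_support H (h k) (h (S k)) HH (Hh k)); split; auto. }
  assert (Hom : forall k, homeo (h k)) by (intros k; apply (sg_homeo H); auto).
  (* The successor makes the exponent positive, so [e k] and [h k] have the same fixed points;
     positive powers of [e k] are powers of [h k] past the threshold [N k]. *)
  set (e := fun k => pw (h k) (S (N k))).
  assert (Fix_e : forall k z, e k z = z <-> h k z = z)
    by (intros k z; apply pw_fix_iff; auto; lia).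
  assert (He : forall k, homeo (e k)) by (intros k; apply homeo_pw; auto).
  assert (pw_e : forall k n z, pw (e k) n z = pw (h k) (n * S (N k)) z).
  { intros k n z; induction n as [|n IH]; [reflexivity|].
    change (pw (e k) (S n) z) with (e k (pw (e k) n z)).
    rewrite IH; replace (S n * S (N k))%nat with (S (N k) + n * S (N k))%nat by lia.
    rewrite pw_add; auto. }
  assert (Pos : forall k d z, (0 < d)%Z -> h (S k) z <> z ->
            h (S k) (zp (e k) d z) = zp (e k) d z).
  { intros k d z Hd Mz; unfold zp.
    replace (Z.to_nat (- d)) with 0%nat by lia; simpl pw at 2 4; rewrite pw_e.
    apply HN; auto; destruct (Z.to_nat d) eqn:E; [lia|]; simpl; lia. }
  exists e; split; [split; [auto|split]|split].
  - intros k z Mz E; apply Mz, Fix_e; apply Fix_e in E.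
    destruct (Nh k z E) as (r & Hr & Hid); apply Hid; lra.
  - intros k d z Mz Hd; rewrite Fix_e in *.
    destruct (Z_lt_le_dec d 0) as [Hd0|Hd0]; [|apply Pos; auto; lia].
    (* For negative [d], the power [- d] would carry a moved image back to [z], which would then be
       fixed. *)
    apply NNPP; intros Mz'; apply (Pos k (- d)%Z) in Mz'; [|lia].
    rewrite <- zp_add in Mz' by auto.
    replace (- d + d)%Z with 0%Z in Mz' by lia; auto.
  - intros k; apply sg_pw; auto.
  - intros k; destruct (Mh k) as [z Hz]; exists z; rewrite Fix_e; auto.
Qed.

(** * The wreath product acting on addresses *)

(* The address (s 0, ..., s (k - 1)) stands for e_(k-1)^(s (k-1)), then ..., then e_0^(s 0). *)
Fixpoint place (e : nat -> R -> R) (k : nat) (s : seqZ) (p : R) : R :=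
  match k with O => p | S j => place e j s (zp (e j) (s j) p) end.

(** The counterpart of [wz_shift j y d]: a power of [e j] transported to the translate of its
    support at address [y]. *)
Definition gen (e : nat -> R -> R) (j : nat) (y : seqZ) (d : Z) : R -> R :=
  cj (zp (e j) d) (place e j y).

(** The points with an address of length [k]: the union of the translates of the support of
    [e k]. *)
Definition Rep (e : nat -> R -> R) (k : nat) (x : R) : Prop :=
  exists s p, e k p <> p /\ x = place e k s p.

Lemma homeo_place e k s : nested e -> homeo (place e k s).
Proof.
  intros He; induction k.
  - split; simpl; eauto.
  - apply (homeo_comp (zp (e k) (s k)) (place e k s)); auto; apply homeo_zp; apply He.
Qed.

Lemma place_ext e k s s' p : (forall i, (i < k)%nat -> s i = s' i) ->
  place e k s p = place e k s' p.
Proof.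
  revert p; induction k; intros p Hs; simpl; auto.
  rewrite (Hs k) by lia; apply IHk; auto.
Qed.

(** Supports decrease along [e], and powers of a map preserve its support; so the last coordinates
    can be absorbed into the base point. *)
Lemma place_drop e j k s p : nested e -> (j <= k)%nat -> e k p <> p ->
  exists p', e j p' <> p' /\ place e k s p = place e j s p'.
Proof.
  intros He Hjk; revert p; induction Hjk as [|k Hjk IH]; intros p Mp; [eauto|].
  simpl; apply IH; rewrite zp_moved by apply He; apply He; auto.
Qed.

(** If the last coordinates differed, one base point would be the image of the other under a nonzero
    power of [e k], hence fixed by [e (S k)]. *)
Lemma place_inj e k s s' p p' : nested e -> e k p <> p -> e k p' <> p' ->
  place e k s p = place e k s' p' -> (forall i, (i < k)%nat -> s i = s' i) /\ p = p'.
Proof.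
  intros He; pose proof He as (Hom & Hsub & Hdis).
  revert p p'; induction k as [|k IH]; intros p p' Mp Mp' E.
  - split; auto; intros; lia.
  - apply IH in E; try (rewrite zp_moved by auto; auto); destruct E as [Es Ep].
    assert (Ed : zp (e k) (s k - s' k) p = p').
    { replace (s k - s' k)%Z with (- s' k + s k)%Z by lia.
      rewrite zp_add, Ep, <- zp_add by auto.
      replace (- s' k + s' k)%Z with 0%Z by lia; auto. }
    destruct (Z.eq_dec (s k) (s' k)) as [Eq|Ne].
    + split.
      * intros i Hi; destruct (Nat.eq_dec i k) as [->|]; auto; apply Es; lia.
      * rewrite <- Ed, Eq, Z.sub_diag; auto.
    + exfalso; apply Mp'; rewrite <- Ed; apply Hdis; auto; lia.
Qed.

Lemma agree_spec k y s : agree k y s = true <-> forall i, (i < k)%nat -> s i = y i.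
Proof.
  unfold agree; rewrite forallb_forall; split; intros Hi i Hik.
  - apply Z.eqb_eq, Hi, in_seq; lia.
  - apply Z.eqb_eq, Hi; apply in_seq in Hik; lia.
Qed.

Lemma wz_shift_other k y d s i : i <> k -> wz_shift k y d s i = s i.
Proof.
  intros Hi; unfold wz_shift; destruct (agree k y s); auto.
  destruct (Nat.eqb_spec i k); congruence.
Qed.

(** If the prefix agrees with [y], the exponents of [e j] add up; if not, the point lies in another
    translate, which the generator fixes by uniqueness of addresses. *)
Lemma gen_place e j y d k s p : nested e -> (j <= k)%nat -> e k p <> p ->
  gen e j y d (place e (S k) s p) = place e (S k) (wz_shift j y d s) p.
Proof.
  intros He Hjk; pose proof He as (Hom & Hsub & _); revert p; induction Hjk as [|k Hjk IH]; intros p Mp.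
  - assert (Mq : e j (zp (e j) (s j) p) <> zp (e j) (s j) p) by (rewrite zp_moved; auto).
    unfold wz_shift; destruct (agree j y s) eqn:Ea; simpl.
    + rewrite agree_spec in Ea; rewrite Nat.eqb_refl.
      rewrite (place_ext e j s y) by auto.
      rewrite (place_ext e j (fun i => if Nat.eqb i j then (s i + d)%Z else s i) y).
      2: { intros i Hi; destruct (Nat.eqb_spec i j); [lia|auto]. }
      unfold gen, cj; rewrite homeo_invK by (apply homeo_place; auto).
      rewrite <- zp_add by auto; rewrite Z.add_comm; auto.
    + set (x := place e j s _); apply NNPP; intros Mx.
      set (r := inv (place e j y) x).
      assert (Ex : x = place e j y r)
        by (unfold r; rewrite homeo_Kinv; auto; apply homeo_place; auto).
      assert (Mr : e j r <> r).
      { intros E; apply Mx; unfold gen, cj; fold r; rewrite zp_fix; auto. }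
      apply (place_inj e j) in Ex; auto.
      assert (agree j y s = true) by (apply agree_spec; apply Ex); congruence.
  - change (place e (S (S k)) s p) with (place e (S k) s (zp (e (S k)) (s (S k)) p)).
    rewrite IH by (apply Hsub; rewrite zp_moved; auto).
    change (place e (S (S k)) (wz_shift j y d s) p)
      with (place e (S k) (wz_shift j y d s) (zp (e (S k)) (wz_shift j y d s (S k)) p)).
    rewrite wz_shift_other by lia; auto.
Qed.

Lemma gen_fix e j y d k x : nested e -> ~ Rep e k x -> (k <= j)%nat -> gen e j y d x = x.
Proof.
  intros He Nx Hkj; apply NNPP; intros Mx; apply Nx.
  assert (Hpl : homeo (place e j y)) by (apply homeo_place; auto).
  destruct (place_drop e k j y (inv (place e j y) x)) as (p & Mp & Ep); auto.
  - intros E; apply Mx; unfold gen, cj; rewrite zp_fix, homeo_Kinv; auto; apply He.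
  - exists y, p; split; auto; rewrite <- Ep, homeo_Kinv; auto.
Qed.

Lemma gen_opp e j y d x : nested e -> gen e j y (- d) (gen e j y d x) = x.
Proof.
  intros He; assert (Hpl : homeo (place e j y)) by (apply homeo_place; auto).
  unfold gen, cj; rewrite homeo_invK, <- zp_add by (auto; apply He).
  replace (- d + d)%Z with 0%Z by lia; apply homeo_Kinv; auto.
Qed.

Lemma Rep_gen e j y d k x : nested e -> Rep e (S k) (gen e j y d x) -> Rep e (S k) x.
Proof.
  intros He (s & p & Mp & E); apply NNPP; intros Nx.
  destruct (le_lt_dec j k) as [Hjk|Hjk].
  - apply Nx; exists (wz_shift j y (- d) s), p; split; auto.
    rewrite <- gen_place by (auto; apply He; auto); rewrite <- E, gen_opp; auto.
  - apply Nx; rewrite <- (gen_fix e j y d (S k) x); auto; exists s, p; auto.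
Qed.

(** * Words in the generators and their two actions *)

Definition word : Type := list (nat * seqZ * Z).

Fixpoint evalZ (w : word) (s : seqZ) : seqZ :=
  match w with nil => s | (j, y, d) :: w' => wz_shift j y d (evalZ w' s) end.

(** Elements of [WZinf] are bare functions, so the homomorphism is first defined on words and then
    shown to depend only on the action on [seqZ]. *)
Fixpoint evalR (e : nat -> R -> R) (w : word) (x : R) : R :=
  match w with nil => x | (j, y, d) :: w' => gen e j y d (evalR e w' x) end.

Definition level_le (w : word) (n : nat) : Prop :=
  forall j y d, In (j, y, d) w -> (j <= n)%nat.

Lemma level_bound w : exists n, forall m, (n <= m)%nat -> level_le w m.
Proof.
  induction w as [|[[j y] d] w [n Hn]].
  - exists 0%nat; intros m _ j y d [].
  - exists (max j n); intros m Hm j' y' d' [E|Hin].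
    + inversion E; subst; lia.
    + apply (Hn m ltac:(lia) j' y' d' Hin).
Qed.

Lemma Rep_evalR e w k x : nested e -> Rep e (S k) (evalR e w x) -> Rep e (S k) x.
Proof.
  intros He; induction w as [|[[j y] d] w IH]; simpl; auto.
  intros HR; apply IH; apply Rep_gen in HR; auto.
Qed.

(** Generators of level up to [k] act by shifts; higher ones either do not occur or fix the points
    reached, which have no address of length [S k]. *)
Lemma evalR_place e w k s p : nested e -> e k p <> p ->
  ~ Rep e (S k) (place e (S k) s p) \/ level_le w k ->
  evalR e w (place e (S k) s p) = place e (S k) (evalZ w s) p.
Proof.
  intros He Mp; induction w as [|[[j y] d] w IH]; intros Hw; [reflexivity|].
  change (evalR e ((j, y, d) :: w) (place e (S k) s p))
    with (gen e j y d (evalR e w (place e (S k) s p))).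
  change (evalZ ((j, y, d) :: w) s) with (wz_shift j y d (evalZ w s)).
  assert (IH' : evalR e w (place e (S k) s p) = place e (S k) (evalZ w s) p).
  { apply IH; destruct Hw as [?|Hw]; auto; right; intros j' y' d' Hin; apply (Hw j' y' d'); right; auto. }
  destruct (le_lt_dec j k) as [Hjk|Hjk].
  - rewrite IH'; apply gen_place; auto.
  - destruct Hw as [Nx|Hw]; [|specialize (Hw j y d (or_introl eq_refl)); lia].
    rewrite (gen_fix e j y d (S k)); auto; [|intros HR; apply Nx; eapply Rep_evalR; eauto].
    rewrite IH'; apply place_ext; intros i Hi; rewrite wz_shift_other; auto; lia.
Qed.

(** The address of [x] is lengthened as far as possible, stopping at level [n]. *)
Lemma locate e n x : nested e -> ~ Rep e 0 x \/
  exists k s p, e k p <> p /\ x = place e (S k) s p /\ (~ Rep e (S k) x \/ k = n).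
Proof.
  intros He; induction n as [|n IH].
  - destruct (classic (Rep e 0 x)) as [(s & p & Mp & E)|?]; auto; right.
    exists 0%nat, (fun _ => 0%Z), p; auto.
  - destruct IH as [?|(k & s & p & Mp & E & Hk)]; auto; right.
    destruct (classic (Rep e (S k) x)) as [HR|?]; [|eauto 10].
    destruct Hk as [?| ->]; [contradiction|]; destruct HR as (s' & p' & Mp' & E').
    (* The value 0 in coordinate [S n] makes the additional power of [e (S n)] trivial. *)
    exists (S n), (fun i => if Nat.eqb i (S n) then 0%Z else s' i), p'.
    split; [auto|split; [|auto]].
    change (x = place e (S n) (fun i => if Nat.eqb i (S n) then 0%Z else s' i)
      (zp (e (S n)) (if Nat.eqb (S n) (S n) then 0%Z else s' (S n)) p')).
    rewrite Nat.eqb_refl, E'; apply place_ext; intros i Hi.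
    destruct (Nat.eqb_spec i (S n)); [lia|auto].
Qed.

(** A point without any address is fixed by both words; any other has an address, long enough for
    both, on which they act through [evalZ]. *)
Lemma evalR_of_evalZ e w w' : nested e -> evalZ w = evalZ w' -> evalR e w = evalR e w'.
Proof.
  intros He E; apply functional_extensionality; intros x.
  destruct (level_bound w) as [n Hn]; destruct (level_bound w') as [n' Hn'].
  destruct (locate e (max n n') x He) as [Nx|(k & s & p & Mp & -> & Hk)].
  - assert (K : forall v, evalR e v x = x).
    { induction v as [|[[j y] d] v IH]; simpl; auto.
      rewrite IH; apply (gen_fix e j y d 0); auto; lia. }
    rewrite !K; auto.
  - assert (K : forall v, level_le v (max n n') ->
              evalR e v (place e (S k) s p) = place e (S k) (evalZ v s) p).
    { intros v Hv; apply evalR_place; auto; destruct Hk as [?| ->]; auto. }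
    rewrite !K, E; auto; [apply Hn'|apply Hn]; lia.
Qed.

(** Translates of a point moved by [e (S N)] determine their addresses of length [S N], and neither
    word touches the coordinates beyond [N]. *)
Lemma evalZ_of_evalR e w w' : nested e -> (forall k, exists z, e k z <> z) ->
  evalR e w = evalR e w' -> evalZ w = evalZ w'.
Proof.
  intros He Mv E; apply functional_extensionality; intros s.
  destruct (level_bound w) as [n Hn]; destruct (level_bound w') as [n' Hn'].
  set (N := max n n'); destruct (Mv (S N)) as [p Mp].
  assert (Lw : level_le w N) by (apply Hn; lia); assert (Lw' : level_le w' N) by (apply Hn'; lia).
  assert (Mp' : e N p <> p) by (apply He; auto).
  assert (Ep : place e (S N) (evalZ w s) p = place e (S N) (evalZ w' s) p).
  { rewrite <- !evalR_place by auto; rewrite E; auto. }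
  apply place_inj in Ep; auto; destruct Ep as [Ep _].
  assert (K : forall v, level_le v N -> forall i, (N < i)%nat -> evalZ v s i = s i).
  { induction v as [|[[j y] d] v IH]; intros Hv i Hi; simpl; auto.
    rewrite wz_shift_other.
    - apply IH; auto; intros j' y' d' Hin; apply (Hv j' y' d'); right; auto.
    - specialize (Hv j y d (or_introl eq_refl)); lia. }
  apply functional_extensionality; intros i.
  destruct (le_lt_dec i N); [apply Ep; lia|rewrite !K; auto].
Qed.

Lemma sg_evalR H e w : subgroup_PLo H -> (forall k, H (e k)) -> H (evalR e w).
Proof.
  intros HH He.
  assert (Hp : forall j y, H (place e j y)).
  { intros j y; induction j as [|j IH]; [exact (proj1 (proj2 HH))|].
    exact (sg_mul H (zp (e j) (y j)) (place e j y) HH (sg_zp H (e j) (y j) HH (He j)) IH). }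
  induction w as [|[[j y] d] w IH]; [exact (proj1 (proj2 HH))|].
  exact (sg_mul H (evalR e w) (gen e j y d) HH IH
           (sg_cj H _ _ HH (sg_zp H (e j) d HH (He j)) (Hp j y))).
Qed.

Lemma WZinf_word f : WZinf f -> exists w, f = evalZ w.
Proof.
  induction 1 as [|k y f _ [w ->]|k y f _ [w ->]].
  - exists nil; auto.
  - exists ((k, y, 1%Z) :: w); auto.
  - exists ((k, y, (-1)%Z) :: w); auto.
Qed.

Lemma evalZ_app w w' s : evalZ (w ++ w') s = evalZ w (evalZ w' s).
Proof. induction w as [|[[j y] d] w IH]; simpl; congruence. Qed.

Lemma evalR_app e w w' x : evalR e (w ++ w') x = evalR e w (evalR e w' x).
Proof. induction w as [|[[j y] d] w IH]; simpl; congruence. Qed.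

Lemma nested_contains_WZinf H e : subgroup_PLo H -> nested e -> (forall k, H (e k)) ->
  (forall k, exists z, e k z <> z) -> contains_WZinf H.
Proof.
  intros HH He Hin Mv.
  (* A word is chosen for each element, with [nil] as the default outside [WZinf]. *)
  destruct (choose (fun f w => WZinf f -> f = evalZ w)) as [W HW].
  { intros f; destruct (classic (WZinf f)) as [Hf|Hf].
    - destruct (WZinf_word f Hf) as [w Hw]; exists w; auto.
    - exists nil; contradiction. }
  exists (fun f => evalR e (W f)); split; [|split].
  - intros f _; apply sg_evalR; auto.
  - intros f g Hf Hg.
    assert (Hgf : exists w, (fun s => g (f s)) = evalZ w).
    { exists (W g ++ W f)%list; apply functional_extensionality; intros s.
      rewrite evalZ_app, <- HW, <- HW; auto. }
    assert (Hc : WZinf (fun s => g (f s))).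
    { clear Hgf; revert Hg; induction 1 as [|k y g _ IH|k y g _ IH]; auto.
      - apply (WZ_gen k y (fun s => g (f s))); auto.
      - apply (WZ_geninv k y (fun s => g (f s))); auto. }
    (* The word chosen for the composite may differ from the concatenation, but both act alike on
       [seqZ] and therefore on the line. *)
    rewrite (evalR_of_evalZ e (W (fun s => g (f s))) (W g ++ W f)); auto.
    + apply functional_extensionality; intros x; apply evalR_app.
    + rewrite <- HW by auto; apply functional_extensionality; intros s.
      rewrite evalZ_app, <- HW, <- HW; auto.
  - intros f g Hf Hg E; apply evalZ_of_evalR in E; auto.
    rewrite (HW f Hf), (HW g Hg); auto.
Qed.

Theorem theorem8 (H : (R -> R) -> Prop) :
  subgroup_PLo H -> admits_deep_tower H -> contains_WZinf H.
Proof.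
  intros HH HT; destruct (Good_nested H) as (e & He & Hin & Mv).
  - split; auto; right; apply tower_Deep; auto.
  - apply (nested_contains_WZinf H e); auto.
Qed.
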